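(* Let $\mathcal{P}$ be a properly self-dual chiral $4$-polytope of type $\{p,q,p\}$, let $\Phi$ be its base flag, let $\sigma_1,\sigma_2,\sigma_3$ be the distinguished generators of $\Gamma(\mathcal{P})$ with respect to $\Phi$, and let $\overline{\Gamma}(\mathcal{P})$ be the extended group of $\mathcal{P}$. Let $\omega$ be the polarity of $\mathcal{P}$ that fixes $\Phi$ (reversing the order of its elements), put $\tau_0:=\sigma_1\sigma_2\sigma_3$, $\tau_1:=\sigma_1\sigma_2$, $\tau_2:=\omega$, and let $\Lambda:=\langle\tau_0,\tau_1,\tau_2\rangle\leq\overline{\Gamma}(\mathcal{P})$. Then $\Lambda$ is the automorphism group of a regular $3$-polytope $\mathcal{M}$ of type $\{p,2s\}$, where $s$ is the length of the left-Petrie polygons of $\mathcal{P}$. Moreover, $\Lambda=\overline{\Gamma}(\mathcal{P})$.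
   Context: Polytopes. An (abstract) $n$-polytope is a partially ordered set $\mathcal{P}$ with a strictly monotone rank function with range $\{-1,0,\dots,n\}$ such that: there are a smallest face $F_{-1}$ (rank $-1$) and a greatest face $F_n$ (rank $n$); every flag (maximal chain) has exactly $n+2$ faces; $\mathcal{P}$ is strongly flag-connected, i.e. any two flags $\Phi,\Psi$ can be joined by a sequence of flags $\Phi=\Phi_0,\dots,\Phi_k=\Psi$ with $\Phi_{i-1},\Phi_i$ differing in just one face and $\Phi\cap\Psi\subseteq\Phi_i$ for all $i$; and whenever $F\le G$ with ranks $j-1$ and $j+1$ there are exactly two $j$-faces $H$ with $F\le H\le G$. For a flag $\Phi$, $\Phi^i$ ($0\le i\le n-1$) is the unique flag differing from $\Phi$ exactly in the face of rank $i$, and $\Phi^{i_1,\dots,i_k}:=(\Phi^{i_1,\dots,i_{k-1}})^{i_k}$. For faces $F\le G$, the section $G/F$ is $\{H\mid F\le H\le G\}$. Groups. $\Gamma(\mathcal{P})$ is the group of automorphisms (order-preserving bijections). A duality is an order-reversing bijection $\mathcal{P}\to\mathcal{P}$, and a polarity is an involutory duality; $\mathcal{P}$ is self-dual if it has a duality, and then the extended group $\overline{\Gamma}(\mathcal{P})$ is the group of all automorphisms and dualities. All these maps act on the right (products are read left to right). Regularity. $\mathcal{P}$ is regular if $\Gamma(\mathcal{P})$ is transitive on flags; then $\Gamma(\mathcal{P})$ is generated by the involutions $\rho_0,\dots,\rho_{n-1}$ with $\Phi\rho_i=\Phi^i$ (distinguished generators with respect to the base flag $\Phi$), and its type is $\{p_1,\dots,p_{n-1}\}$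 where $p_i$ is the order of $\rho_{i-1}\rho_i$. Chirality. $\mathcal{P}$ (rank $n\ge3$) is chiral if it is not regular but for some base flag $\Phi=\{F_{-1},F_0,\dots,F_n\}$ there are automorphisms $\sigma_1,\dots,\sigma_{n-1}$ such that $\sigma_i$ fixes all faces in $\Phi\setminus\{F_{i-1},F_i\}$ and cyclically permutes consecutive $i$-faces of $\mathcal{P}$ in the rank-2 section $F_{i+1}/F_{i-2}$; they are chosen so that $\Phi\sigma_i=\Phi^{i,i-1}$ and are called the distinguished generators (they generate $\Gamma(\mathcal{P})$). Equivalently, $\Gamma(\mathcal{P})$ has exactly two flag orbits, with adjacent flags always in distinct orbits. The type is $\{p_1,\dots,p_{n-1}\}$, where $p_i$ is the order of $\sigma_i$. A self-dual chiral polytope is properly self-dual if its dualities map each flag to a flag (in reverse order) in the same orbit under $\Gamma(\mathcal{P})$; in this case a unique polarity $\omega$ fixing $\Phi$ exists. Left-Petrie polygons. For a chiral $4$-polytope let $\pi_L:=\sigma_1\sigma_3$. With $F_0,F_1$ the vertex and edge of $\Phi$, the orbits $F_0\langle\pi_L\rangle$ and $F_1\langle\pi_L\rangle$ are the vertex-set and edge-set of a polygon; its images under $\Gamma(\mathcal{P})$ are the left-Petrie polygons of $\mathcal{P}$. Their length is the order of $\pi_L$. *)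

(* Defs.v *)
From HB Require Import structures.
From mathcomp Require Import all_boot all_order all_algebra.
From mathcomp Require Import boolp classical_sets functions cardinality.

Set Implicit Arguments.
Unset Strict Implicit.
Unset Printing Implicit Defensive.

Import Order.TTheory.

Local Open Scope classical_set_scope.

(** * The symmetric group of a possibly infinite type *)

Record sym (T : Type) := Sym {
  sym_fun :> T -> T;
  sym_inv : T -> T;
  sym_funK : cancel sym_fun sym_inv;
  sym_invK : cancel sym_inv sym_fun }.

HB.instance Definition _ (T : Type) := gen_eqMixin (sym T).
HB.instance Definition _ (T : Type) := gen_choiceMixin (sym T).

Lemma symP (T : Type) (g h : sym T) : g =1 h -> g = h.
Proof.
case: g h => [f f' fK f'K] [k k' kK k'K] /= /funext e; subst k.
have e' : f' = k' by apply/funext => x; rewrite -{1}[x]k'K fK.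
by subst k'; rewrite (Prop_irrelevance fK kK) (Prop_irrelevance f'K k'K).
Qed.

Section SymGroup.
Variable T : Type.
Implicit Types g h : sym T.

Definition sym_one : sym T := @Sym T id id (fun=> erefl) (fun=> erefl).

(* Maps act on the right: g * h is g followed by h. *)
Definition sym_mul g h : sym T :=
  @Sym T (h \o g) (sym_inv g \o sym_inv h)
    (can_comp (@sym_funK T h) (@sym_funK T g))
    (can_comp (@sym_invK T g) (@sym_invK T h)).

Definition sym_V g : sym T := Sym (@sym_invK T g) (@sym_funK T g).

Lemma sym_mulA : associative sym_mul. Proof. by move=> f g h; apply: symP. Qed.
Lemma sym_mul1g : left_id sym_one sym_mul. Proof. by move=> g; apply: symP. Qed.
Lemma sym_mulg1 : right_id sym_one sym_mul. Proof. by move=> g; apply: symP. Qed.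
Lemma sym_mulVg : left_inverse sym_one sym_V sym_mul.
Proof. by move=> g; apply: symP => x /=; rewrite sym_invK. Qed.
Lemma sym_mulgV : right_inverse sym_one sym_V sym_mul.
Proof. by move=> g; apply: symP => x /=; rewrite sym_funK. Qed.

HB.instance Definition _ :=
  isGroup.Build (sym T) sym_mulA sym_mul1g sym_mulg1 sym_mulVg sym_mulgV.

End SymGroup.

(** * Subgroups of possibly infinite groups, as sets *)

Section Groups.
Local Open Scope group_scope.

Definition subgroup (G : groupType) (H : set G) :=
  [/\ H 1, forall g h, H g -> H h -> H (g * h) & forall g, H g -> H g^-1].

Definition generated (G : groupType) (A : set G) : set G :=
  smallest (@subgroup G) A.

Definition isomorphic (G1 G2 : groupType) (H1 : set G1) (H2 : set G2) :=
  exists f : G1 -> G2, set_bij H1 H2 f /\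
    forall g h, H1 g -> H1 h -> f (g * h) = f g * f h.

(* Infinite order is encoded as n = 0: only 0 is a multiple of 0. *)
Definition has_order (G : groupType) (g : G) (n : nat) :=
  forall k : nat, g ^+ k = 1 <-> (n %| k)%N.

End Groups.

(** * Abstract polytopes *)

Local Open Scope card_scope.
Local Open Scope ring_scope.

Definition chain d (P : porderType d) (A : set P) :=
  total_on A (fun F G => (F <= G)%O).

Definition flag d (P : porderType d) (A : set P) :=
  chain A /\ forall B, chain B -> A `<=` B -> B = A.

Definition differ_in_one d (P : porderType d) (A B : set P) :=
  exists F G, A `\` B = [set F] /\ B `\` A = [set G].

Definition section d (P : porderType d) (F G : P) : set P :=
  [set H | (F <= H)%O /\ (H <= G)%O].

Record polytope (n : nat) := Polytope {
  polytope_disp : Order.disp_t;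
  face :> porderType polytope_disp;
  rank : face -> int;
  rank_lt : forall F G : face, (F < G)%O -> rank F < rank G;
  rank_range : range rank = [set r : int | -1 <= r <= n%:Z];
  least_face : exists2 F : face, rank F = -1 & forall G, (F <= G)%O;
  greatest_face : exists2 F : face, rank F = n%:Z & forall G, (G <= F)%O;
  flag_card : forall A : set face, flag A -> A #= `I_n.+2;
  strongly_flag_connected : forall A B : set face, flag A -> flag B ->
    exists (k : nat) (C : nat -> set face),
      [/\ C 0%N = A, C k = B,
          forall i, (i <= k)%N -> flag (C i) /\ A `&` B `<=` C i &
          forall i, (i < k)%N -> differ_in_one (C i) (C i.+1)];
  diamond : forall (j : int) (F G : face),
    (F <= G)%O -> rank F = j - 1 -> rank G = j + 1 ->
    [set H | section F G H /\ rank H = j] #= `I_2 }.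

Section PolytopeTheory.
Variables (n : nat) (P : polytope n).
Implicit Types (A : set P) (i : nat).
Local Open Scope group_scope.

Definition differ_at i A (B : set P) :=
  exists F G : P, [/\ A `\` B = [set F], B `\` A = [set G],
                     rank F = i%:Z & rank G = i%:Z].

(* The flag $A^i$; it exists and is unique for a flag A and i < n, and takes
   the default value A otherwise. *)
Definition adj A i : set P := xget A [set B | flag B /\ differ_at i A B].

(* Order preservation is required in both directions, since on an infinite
   poset the inverse of an order-preserving bijection need not preserve the
   order; similarly for dualities. *)
Definition automorphism : set (sym P) :=
  [set g | {mono g : F G / (F <= G)%O}].

Definition duality : set (sym P) :=
  [set g | {mono g : F G /~ (F <= G)%O}].

Definition polarity : set (sym P) := [set g | duality g /\ has_order g 2].

Definition self_dual := duality !=set0.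

Definition extended_group : set (sym P) := automorphism `|` duality.

(** ** Regularity *)

Definition regular := forall A B : set P, flag A -> flag B ->
  exists2 g, automorphism g & g @` A = B.

(* Only rho i for i < n is meaningful. *)
Definition regular_generators A (rho : nat -> sym P) :=
  flag A /\ forall i, (i < n)%N ->
    automorphism (rho i) /\ rho i @` A = adj A i.

Definition regular_of_type (ps : seq nat) :=
  [/\ regular, size ps = n.-1 &
      exists A rho, regular_generators A rho /\
        forall i, (i < n.-1)%N -> has_order (rho i * rho i.+1) (nth 0%N ps i)].

(** ** Chirality *)

(* i-faces H and K of the section G/F of rank 2 that are consecutive in it *)
Definition consecutive i (F G H K : P) :=
  [/\ H <> K, section F G H /\ rank H = i%:Z, section F G K /\ rank K = i%:Z &
      exists E, [/\ section F G E, rank E = (i%:Z - 1)%R, (E <= H)%O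
                  & (E <= K)%O]].

(* g maps each i-face of G/F to a consecutive one, and the i-faces of G/F
   form a single cycle (possibly infinite) of g. *)
Definition cycles_consecutive i (F G : P) (g : sym P) :=
  (forall H, section F G H -> rank H = i%:Z -> consecutive i F G H (g H)) /\
  (forall H K, section F G H -> rank H = i%:Z ->
               section F G K -> rank K = i%:Z ->
     exists k : nat, (g ^+ k) H = K \/ (g ^+ k) K = H).

(* Only s i for 1 <= i <= n-1 is meaningful. *)
Definition rotations A (s : nat -> sym P) :=
  flag A /\ forall i, (0 < i < n)%N ->
    [/\ automorphism (s i),
        forall F, A F -> rank F <> (i%:Z - 1)%R -> rank F <> i%:Z -> s i F = F &
        forall F G, A F -> A G -> rank F = (i%:Z - 2)%R ->
          rank G = (i%:Z + 1)%R -> cycles_consecutive i F G (s i)].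

Definition chiral :=
  [/\ (3 <= n)%N, ~ regular & exists A s, rotations A s].

Definition chiral_generators A (s : nat -> sym P) :=
  rotations A s /\
  forall i, (0 < i < n)%N -> s i @` A = adj (adj A i) i.-1.

Definition chiral_type (s : nat -> sym P) (ps : seq nat) :=
  size ps = n.-1 /\
  forall i, (0 < i < n)%N -> has_order (s i) (nth 0%N ps i.-1).

Definition properly_self_dual :=
  self_dual /\ forall d A, duality d -> flag A ->
    exists2 g, automorphism g & d @` A = g @` A.

End PolytopeTheory.

(** ** Left-Petrie polygons *)

Section Petrie.
Variable P : polytope 4.
Local Open Scope group_scope.

Definition pi_L (s : nat -> sym P) : sym P := s 1%N * s 3%N.

(* The left-Petrie polygons are the images under the automorphism group of the
   polygon traced by a base vertex and a base edge under powers of pi_L; their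
   common length is by definition the order of pi_L. *)
Definition left_petrie_length (s : nat -> sym P) (l : nat) :=
  has_order (pi_L s) l.

End Petrie.

(* Main.v *)
From HB Require Import structures.
Require Import Defs.
From mathcomp Require Import all_boot all_order all_algebra zify.
From mathcomp Require Import boolp classical_sets functions cardinality.

(** With beta := sigma_2 sigma_3 = omega tau_1 omega, the elements tau_0, tau_1
  and beta are involutions that send Phi to Phi^{3,0}, Phi^{2,0} and Phi^{3,1},
  and sigma_1 = tau_0 beta and sigma_3 = tau_1 tau_0, so Lambda contains all
  rotations.  Moreover tau_0 tau_1 is conjugate to sigma_3 and
  (tau_1 omega)^2 = tau_1 beta is conjugate to the inverse of sigma_1 sigma_3,
  which gives the type.

  It remains to see that Lambda is a string C-group, M being its coset polytope.
  The only hard case is the intersection of <tau_0, tau_1> and <tau_1, omega>.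
  Up to a factor tau_1, an element r of it lies in <tau_1 omega>, so it is
  inverted by tau_1 and by omega.  It fixes the base edge F_1 because tau_0 and
  tau_1 do, hence also F_2 = F_1 omega; by chirality r is 1 or tau_0.  If
  r = tau_0, then tau_0 is inverted by tau_1 and hence central in the
  automorphism group, so it fixes every edge and exchanges its two vertices;
  exchanging the vertices by tau_0 and fixing all other faces is then an
  automorphism that maps Phi to Phi^0, against chirality. *)
Set Implicit Arguments.
Unset Strict Implicit.
Unset Printing Implicit Defensive.

Import Order.TTheory GRing.Theory Num.Theory.

Local Open Scope classical_set_scope.

(** * Finite cardinalities *)

Section Cardinality.
Local Open Scope card_scope.

Lemma card_II2P T (D : set T) :
  D #= `I_2 <-> exists a b, a <> b /\ D = [set a; b].
Proof.
split=> [/eq_cardSP[a Da /eq_cardSP[b [Db ba]]]|[a [b [ab ->]]]].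
  rewrite II0 card_eq0 => /eqP D0; exists a, b; split=> [e|].
    by apply: ba; rewrite /= e.
  apply/seteqP; split=> [x Dx|x [->|->]//].
  case: (pselect (x = a)) => [->|xa]; first by left.
  case: (pselect (x = b)) => [->|xb]; first by right.
  by have : ((D `\ a) `\ b) x by []; rewrite D0.
apply/eq_cardSP; exists a; first by left.
have -> : [set a; b] `\ a = [set b].
  apply/seteqP; split=> [x [[->|->] xa]|x ->]; [by case: xa|by []|].
  by split; [right | move=> /esym].
exact: card_set1.
Qed.

(** Pigeonhole: a missed value [k], added to the image, would give N + 1 elements among the N
    numbers below N. *)
Lemma inj_image_II T (A : set T) (h : T -> nat) N :
  {in A &, injective h} -> h @` A `<=` `I_N -> A #= `I_N -> h @` A = `I_N.
Proof.
move=> hI hA cA; apply/seteqP; split=> // k kN.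
apply: contrapT => hk.
have /card_eqPle[_] : k |` (h @` A) #= `I_N.+1.
  apply/eq_cardSP; exists k; first by left.
  have -> : (k |` (h @` A)) `\ k = h @` A.
    apply/seteqP; split=> [x [[->|//] /(_ erefl)[]]|x Ax].
    by split; [right | move=> xk; apply: hk; rewrite -xk].
  by rewrite (card_eql (inj_card_eq hI)).
move=> /card_le_trans/(_ (subset_card_le (_ : _ `<=` `I_N))).
rewrite card_le_II ltnn => /(_ _)/notF; apply.
by move=> x [->|/hA].
Qed.

End Cardinality.

(** * The subgroup generated by a set *)

Section Generated.
Variable G : groupType.
Implicit Types (A B : set G) (g h k : G).
Local Open Scope group_scope.

Lemma generated_subgroup A : subgroup (generated A).
Proof.
split.
- by move=> H [[]].
- move=> g h gA hA H HA; have [[_ HM _] _] := HA.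
  by apply: HM; [apply: gA | apply: hA].
- move=> g gA H HA; have [[_ _ HV] _] := HA.
  by apply: HV; apply: gA.
Qed.

Lemma generated1 A : generated A 1.
Proof. by have [] := generated_subgroup A. Qed.

Lemma generatedM A g h : generated A g -> generated A h -> generated A (g * h).
Proof. by have [_ + _] := generated_subgroup A; apply. Qed.

Lemma generatedV A g : generated A g -> generated A g^-1.
Proof. by have [_ _] := generated_subgroup A; apply. Qed.

Lemma mem_generated A g : A g -> generated A g.
Proof. by move=> Ag H [_]; apply. Qed.

Lemma generated_min A (H : set G) :
  subgroup H -> A `<=` H -> generated A `<=` H.
Proof. by move=> sH AH g; apply. Qed.

Lemma generatedS A B : A `<=` B -> generated A `<=` generated B.
Proof.
move=> AB; apply: generated_min; first exact: generated_subgroup.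
by move=> g /AB; apply: mem_generated.
Qed.

(** The elements that, together with their inverses, preserve [Q] under left multiplication form a
    subgroup [S] containing [A]. *)
Lemma generated_ind A (Q : set G) :
  Q 1 -> (forall a g, A a -> Q g -> Q (a * g)) ->
  (forall a g, A a -> Q g -> Q (a^-1 * g)) -> generated A `<=` Q.
Proof.
move=> Q1 QM QV.
pose S : set G := [set g | forall h, Q h -> Q (g * h) /\ Q (g^-1 * h)].
have sS : subgroup S.
  split; [move=> h|move=> g k Sg Sk h Qh|move=> g Sg h /(Sg h)].
  - by rewrite invg1 mul1g.
  - rewrite invgM -!mulgA; have [/(Sg _)[? _] _] := Sk _ Qh.
    by have [_ /(Sk _)[_ ?]] := Sg _ Qh.
  - by rewrite invgK => -[].
move=> g Ag; have /(_ _ Q1)[] : S g; last by rewrite mulg1.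
by apply: generated_min Ag => // a Aa h Qh; split; [apply: QM | apply: QV].
Qed.

End Generated.

(** * Flags *)

Section Flags.
Variables (n : nat) (P : polytope n).
Implicit Types (A B C : set P) (x y z : P) (g h d : sym P) (i j : nat).
Local Open Scope ring_scope.

Lemma rank_bounds x : -1 <= rank x <= n%:Z.
Proof.
have : range (@rank n P) (rank x) by exists x.
by rewrite rank_range.
Qed.

Lemma rank_le x y : (x <= y)%O -> rank x <= rank y.
Proof. by rewrite le_eqVlt => /predU1P[->//|/rank_lt/ltW]. Qed.

Lemma rank_le_eq x y : (x <= y)%O -> rank x = rank y -> x = y.
Proof. by rewrite le_eqVlt => /predU1P[//|/rank_lt + e]; rewrite e ltxx. Qed.

Lemma chain_rank_inj A x y :
  chain A -> A x -> A y -> rank x = rank y -> x = y.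
Proof.
by move=> cA Ax Ay e; have [/rank_le_eq->|/rank_le_eq->] := cA _ _ Ax Ay.
Qed.

Lemma chain_le A x y : chain A -> A x -> A y -> rank x <= rank y -> (x <= y)%O.
Proof.
move=> cA Ax Ay r; have [//|yx] := cA _ _ Ax Ay.
have -> // : x = y.
by apply: chain_rank_inj cA Ax Ay _; apply/le_anti; rewrite r rank_le.
Qed.

Lemma chain_sub_flag A : chain A -> exists2 B, flag B & A `<=` B.
Proof.
(* Zorn's lemma is run on the sets [X] whose union with [A] is a chain, so that the empty family
   needs no separate treatment. *)
move=> cA; pose Q X := chain (X `|` A).
have [|B [cB Bmax]] := @Zorn_bigcup _ Q.
  move=> F FQ Ftot x y.
  have Fc X u v : F X -> (X `|` A) u -> (X `|` A) v -> (u <= v \/ v <= u)%O.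
    by move=> /FQ; apply.
  case=> [[X FX Xx]|Ax] [[Y FY Yy]|Ay].
  - have [XY|YX] := Ftot _ _ FX FY.
      by apply: (Fc Y) => //; left => //; apply: XY.
    by apply: (Fc X) => //; left => //; apply: YX.
  - by apply: (Fc X); [|left|right].
  - by apply: (Fc Y); [|right|left].
  - exact: cA.
exists (B `|` A); last by move=> x; right.
split=> // C cC BAC; apply/seteqP; split=> // x Cx; left.
apply: contrapT => Bx.
have [|] := Bmax C.
  split; first by move=> y By; apply: BAC; left.
  by move=> /(_ _ Cx).
rewrite /Q (_ : C `|` A = C) //; apply/seteqP; split=> [y [//|Ay]|y];
  last by left.
by apply: BAC; right.
Qed.

Lemma flag_chain A : flag A -> chain A. Proof. by case. Qed.

(** The rank plus one maps the n + 2 faces of a flag injectively into the n + 2 numbers below n + 2,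
    hence onto them. *)
Lemma flag_face A (r : int) :
  flag A -> -1 <= r <= n%:Z -> exists2 x, A x & rank x = r.
Proof.
move=> fA rn; pose h x := absz (rank x + 1).
have hE x : (h x)%:Z = rank x + 1 by have := rank_bounds x; rewrite /h; lia.
have hI : {in A &, injective h}.
  move=> x y /set_mem Ax /set_mem Ay e.
  by apply: (chain_rank_inj (flag_chain fA)) => //; have := hE x; have := hE y;
    lia.
have hA : h @` A `<=` `I_n.+2.
  by move=> _ [x _ <-] /=; have := hE x; have := rank_bounds x; lia.
have /seteqP[_ /(_ (absz (r + 1)))] := inj_image_II hI hA (flag_card fA).
by case=> [/=|x Ax e]; [lia | exists x => //; have := hE x; lia].
Qed.

(** Trades maximality for a condition that can be checked rank by rank: a face added to such a chain
    would share its rank with a face already there. *)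
Lemma flagP A : flag A <->
  chain A /\ forall r : int, -1 <= r <= n%:Z -> exists2 x, A x & rank x = r.
Proof.
split=> [fA|[cA rA]]; first by split=> [|r]; [case: fA | apply: flag_face].
split=> // B cB AB; apply/seteqP; split=> // x Bx.
have [y Ay e] := rA _ (rank_bounds x).
by rewrite -(chain_rank_inj cB (AB _ Ay) Bx e).
Qed.

Lemma flag_sub_eq A B : flag A -> flag B -> A `<=` B -> A = B.
Proof. by move=> [_ m] [cB _] AB; rewrite (m B). Qed.

Lemma face_in_flag x : exists2 A, flag A & A x.
Proof.
have [|A fA xA] := @chain_sub_flag [set x]; last by exists A => //; apply: xA.
by move=> _ _ -> ->; left.
Qed.

Lemma le_in_flag x y : (x <= y)%O -> exists A, [/\ flag A, A x & A y].
Proof.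
move=> xy; have [|A fA xA] := @chain_sub_flag [set x; y].
  by move=> _ _ [->|->] [->|->]; rewrite ?lexx; auto.
by exists A; split=> //; apply: xA; [left | right].
Qed.

Lemma rank_least x : rank x = -1 -> forall y, (x <= y)%O.
Proof.
have [z rz zmin] := least_face P => rx y.
by rewrite -(rank_le_eq (zmin x)) ?rz ?rx.
Qed.

Lemma rank_greatest x : rank x = n%:Z -> forall y, (y <= x)%O.
Proof.
have [z rz zmax] := greatest_face P => rx y.
by rewrite (rank_le_eq (zmax x)) ?rz ?rx.
Qed.

Lemma flag_improper A x : flag A -> rank x = -1 \/ rank x = n%:Z -> A x.
Proof.
move=> fA rx; have [y Ay ry] := flag_face fA (rank_bounds x).
suff -> : x = y by [].
case: rx => rx; first exact: rank_le_eq (rank_least rx y) (esym ry).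
exact/esym/(rank_le_eq (rank_greatest rx y)).
Qed.

(** * Adjacent flags *)

(** Comparing [x] with its two neighbours in rank suffices, since the other faces of [A] lie below
    the one or above the other. *)
Lemma flag_replace A x j : flag A -> rank x = j%:Z ->
  (forall y, A y -> rank y = j%:Z - 1 -> (y <= x)%O) ->
  (forall y, A y -> rank y = j%:Z + 1 -> (x <= y)%O) ->
  flag [set y | A y /\ rank y <> j%:Z \/ y = x].
Proof.
move=> fA rx lx xl; apply/flagP; have cA := flag_chain fA.
have cmp y : A y -> rank y <> j%:Z -> (x <= y \/ y <= x)%O.
  move=> Ay ry; have := rank_bounds y; have := rank_bounds x;
    rewrite rx => bx by_.
  have [lt|gt] : rank y <= j%:Z - 1 \/ j%:Z + 1 <= rank y by lia.
    right; have [|z Az rz] := @flag_face A (j%:Z - 1) fA; first by lia.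
    by apply: le_trans (lx _ Az rz); apply: (chain_le cA); rewrite ?rz.
  left; have [|z Az rz] := @flag_face A (j%:Z + 1) fA; first by lia.
  by apply: le_trans (xl _ Az rz) _; apply: (chain_le cA); rewrite ?rz.
split=> [y z [[Ay ry]|->] [[Az rz]|->]|r rn].
- exact: cA.
- by have [] := cmp y Ay ry; auto.
- exact: cmp.
- by left.
- have [->|/eqP rj] := eqVneq r j%:Z; first by exists x => //; right.
  by have [y Ay ry] := flag_face fA rn; exists y => //; left; rewrite ry.
Qed.

Lemma diamond_uniq i x y z u v : (i < n)%N ->
  rank x = i%:Z -> rank y = i%:Z -> rank z = i%:Z -> y <> x -> z <> x ->
  rank u = i%:Z - 1 -> rank v = i%:Z + 1 ->
  (u <= x <= v)%O -> (u <= y <= v)%O -> (u <= z <= v)%O -> y = z.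
Proof.
move=> ltin rx ry rz yx zx ru rv /andP[ux xv] /andP[uy yv] /andP[uz zv].
have /card_II2P[a [b [_ D]]] := diamond (le_trans ux xv) ru rv.
have Dab w : (u <= w <= v)%O -> rank w = i%:Z -> w = a \/ w = b.
  by move=> /andP[uw wv] rw; have : [set a; b] w by rewrite -D.
have [ex|ex] := Dab x (introT andP (conj ux xv)) rx;
have [ey|ey] := Dab y (introT andP (conj uy yv)) ry;
have [ez|ez] := Dab z (introT andP (conj uz zv)) rz; congruence.
Qed.

(** Both [B] and [C] exchange the face [a] of rank i for another one between the same faces [u] and
    [v], and the diamond condition leaves one candidate. *)
Lemma adj_uniq A B C i : (i < n)%N -> flag A -> flag B -> flag C ->
  B <> A -> C <> A ->
  (forall x, A x -> rank x <> i%:Z -> B x) ->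
  (forall x, A x -> rank x <> i%:Z -> C x) -> B = C.
Proof.
move=> ltin fA fB fC BA CA AB AC.
have [|a Aa ra] := @flag_face A i%:Z fA; first by lia.
have [|u Au ru] := @flag_face A (i%:Z - 1) fA; first by lia.
have [|v Av rv] := @flag_face A (i%:Z + 1) fA; first by lia.
have key D : flag D -> D <> A -> (forall x, A x -> rank x <> i%:Z -> D x) ->
    exists b, [/\ D b, rank b = i%:Z, b <> a, (u <= b)%O & (b <= v)%O].
  move=> fD DA AD; have [|b Db rb] := @flag_face D i%:Z fD; first by lia.
  exists b; split=> //.
  - move=> ba; apply: DA; apply/esym/flag_sub_eq => // x Ax.
    have [rx|/eqP/(AD _ Ax)//] := eqVneq (rank x) i%:Z.
    by rewrite (chain_rank_inj (flag_chain fA) Ax Aa) ?rx // -ba.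
  - apply: (chain_le (flag_chain fD)) => //; last by rewrite ru rb; lia.
    by apply: AD => //; lia.
  - apply: (chain_le (flag_chain fD)) => //; last by rewrite rv rb; lia.
    by apply: AD => //; lia.
have [b [Bb rb ba ub bv]] := key _ fB BA AB.
have [c [Cc rc ca uc cv]] := key _ fC CA AC.
have ubv : (u <= b <= v)%O by apply/andP.
have ucv : (u <= c <= v)%O by apply/andP.
have uav : (u <= a <= v)%O.
  by apply/andP; split; apply: (chain_le (flag_chain fA));
    rewrite ?ru ?rv ?ra //; lia.
have bc := diamond_uniq ltin ra rb rc ba ca ru rv uav ubv ucv.
apply: flag_sub_eq => // x Bx.
have [y Ay ry] := flag_face fA (rank_bounds x).
have [rx|/eqP rx] := eqVneq (rank x) i%:Z.
  by rewrite (chain_rank_inj (flag_chain fB) Bx Bb) ?rb // bc.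
have By : B y by apply: AB; rewrite ?ry.
by rewrite (chain_rank_inj (flag_chain fB) Bx By) //; apply: AC; rewrite ?ry.
Qed.

Lemma differ_at_sub A B i : differ_at i A B ->
  B <> A /\ (forall x, A x -> rank x <> i%:Z -> B x).
Proof.
move=> [F [H [AB BA rF rH]]]; split=> [e|x Ax rx].
  by move: AB; rewrite e setDv => /seteqP[_ /(_ F)]; apply.
apply: contrapT => Bx; have : (A `\` B) x by [].
by rewrite AB => xF; apply: rx; rewrite xF.
Qed.

Lemma sub_differ_at A B i : (i < n)%N -> flag A -> flag B -> B <> A ->
  (forall x, A x -> rank x <> i%:Z -> B x) -> differ_at i A B.
Proof.
move=> ltin fA fB BA AB.
have [|a Aa ra] := @flag_face A i%:Z fA; first by lia.
have [|b Bb rb] := @flag_face B i%:Z fB; first by lia.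
have ba : b <> a.
  move=> ba; apply: BA; apply/esym/flag_sub_eq => // x Ax.
  have [rx|/eqP/(AB _ Ax)//] := eqVneq (rank x) i%:Z.
  by rewrite (chain_rank_inj (flag_chain fA) Ax Aa) ?rx // -ba.
have cA := flag_chain fA; have cB := flag_chain fB.
exists a, b; split=> //; apply/seteqP; split=> [x [Ax Bx]|_ ->].
- have [rx|/eqP/(AB _ Ax)//] := eqVneq (rank x) i%:Z.
  by apply: (chain_rank_inj cA); rewrite ?ra.
- by split=> // Ba; apply: ba; apply: (chain_rank_inj cB); rewrite ?ra.
- have [rx|/eqP rx] := eqVneq (rank x) i%:Z.
    by apply: (chain_rank_inj cB); rewrite ?rb.
  case: Bx; have [y Ay ry] := flag_face fA (rank_bounds x).
  rewrite (chain_rank_inj cB Ax _ (esym ry)) //.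
  by apply: AB; rewrite ?ry.
- by split=> // Ab; apply: ba; apply: (chain_rank_inj cA); rewrite ?ra.
Qed.

(** The diamond condition supplies a second face [b] between the neighbours of [a], so under these
    hypotheses the default value of [adj] never arises. *)
Lemma adj_spec A i : (i < n)%N -> flag A ->
  [/\ flag (adj A i), adj A i <> A
    & forall x, A x -> rank x <> i%:Z -> adj A i x].
Proof.
move=> ltin fA; rewrite /adj; case: xgetP => [B _ [fB AB]|none].
  by have [? ?] := differ_at_sub AB.
have [|a Aa ra] := @flag_face A i%:Z fA; first by lia.
have [|u Au ru] := @flag_face A (i%:Z - 1) fA; first by lia.
have [|v Av rv] := @flag_face A (i%:Z + 1) fA; first by lia.
have cA := flag_chain fA.
have ua : (u <= a)%O by apply: (chain_le cA) => //; lia.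
have av : (a <= v)%O by apply: (chain_le cA) => //; lia.
have [b [ub bv rb ba]]
  : exists b, [/\ (u <= b)%O, (b <= v)%O, rank b = i%:Z & b <> a].
  have /card_II2P[c [d [cd D]]] := diamond (le_trans ua av) ru rv.
  have [[uc cv] rc] : [set H | section u v H /\ rank H = i%:Z] c.
    by rewrite D; left.
  have [[ud dv] rd] : [set H | section u v H /\ rank H = i%:Z] d.
    by rewrite D; right.
  have [ca|ca] := pselect (c = a); last by exists c.
  by exists d; split=> // da; apply: cd; rewrite ca da.
pose B := [set y | A y /\ rank y <> i%:Z \/ y = b].
have fB : flag B.
  apply: flag_replace => // y Ay ry.
    by rewrite (chain_rank_inj cA Ay Au) ?ru.
  by rewrite (chain_rank_inj cA Ay Av) ?rv.
case: (none B); split=> //; apply: sub_differ_at => //.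
  move=> BA; apply: ba; apply: (chain_rank_inj cA) => //; last by rewrite ra.
  by rewrite -BA; right.
by move=> x Ax rx; left.
Qed.

Lemma adj_flag A i : (i < n)%N -> flag A -> flag (adj A i).
Proof. by move=> ltin /(adj_spec ltin)[]. Qed.

Lemma adj_eq A B i : (i < n)%N -> flag A -> flag B -> B <> A ->
  (forall x, A x -> rank x <> i%:Z -> B x) -> adj A i = B.
Proof.
by move=> ltin fA fB BA AB; have [? ? ?] := adj_spec ltin fA;
  apply: adj_uniq AB.
Qed.

Lemma adj_sub A i x : (i < n)%N -> flag A -> rank x <> i%:Z ->
  adj A i x <-> A x.
Proof.
move=> ltin fA rx; have [fB _ AB] := adj_spec ltin fA.
split=> [Bx|/AB]; last exact.
have [y Ay ry] := flag_face fA (rank_bounds x).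
rewrite (chain_rank_inj (flag_chain fB) Bx _ (esym ry)) //.
by apply: AB; rewrite ?ry.
Qed.

Lemma adjK A i : (i < n)%N -> flag A -> adj (adj A i) i = A.
Proof.
move=> ltin fA; have [fB BA _] := adj_spec ltin fA.
by apply: adj_eq => // [/esym//|x Bx rx]; rewrite -(adj_sub ltin fA rx).
Qed.

Lemma adj_new A i x : (i < n)%N -> flag A -> rank x = i%:Z -> adj A i x ->
  ~ A x.
Proof.
move=> ltin fA rx Bx Ax; have [fB BA AB] := adj_spec ltin fA.
apply: BA; apply/esym/flag_sub_eq => // y Ay.
have [ry|/eqP/(AB _ Ay)//] := eqVneq (rank y) i%:Z.
by rewrite (chain_rank_inj (flag_chain fA) Ay Ax) ?rx.
Qed.

(** As i and j are not consecutive, exchanging both faces of [A] at once gives a flag [D], adjacent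
    to [adj A i] in rank j and to [adj A j] in rank i. *)
Lemma adjC A i j : (i.+1 < j)%N -> (j < n)%N -> flag A ->
  adj (adj A i) j = adj (adj A j) i.
Proof.
move=> ij jn fA; have ltin : (i < n)%N by lia.
have fi := adj_flag ltin fA; have fj := adj_flag jn fA.
have [|b Bb rb] := @flag_face (adj A j) j%:Z fj; first by lia.
have [|c Bc rc] := @flag_face (adj A i) i%:Z fi; first by lia.
have cj := flag_chain fj.
have ij_sub y : rank y <> i%:Z -> rank y <> j%:Z -> adj A i y <-> adj A j y.
  by move=> yi yj; rewrite (adj_sub ltin fA yi) (adj_sub jn fA yj).
pose D := [set y | adj A i y /\ rank y <> j%:Z \/ y = b].
have fD : flag D.
  apply: flag_replace => // y /ij_sub Iy ry; apply: (chain_le cj) => //;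
    try lia.
    by apply: Iy; lia.
  by apply: Iy; lia.
transitivity D; last apply/esym.
  apply: adj_eq => // [e|x Ax rx]; last by left.
  apply: (adj_new jn fA rb Bb); apply/(adj_sub ltin fA); first by lia.
  by rewrite -e; right.
apply: adj_eq => // [e|x Ax rx].
  apply: (adj_new ltin fA rc Bc); apply/(adj_sub jn fA); first by lia.
  by rewrite -e; left; split=> //; lia.
have [rj|/eqP rj] := eqVneq (rank x) j%:Z; last by left; rewrite ij_sub.
by right; apply: (chain_rank_inj cj); rewrite ?rb.
Qed.

(** The improper faces lie in every flag, so flags can only differ in faces of rank between 0 and n
    - 1. *)
Lemma differ_in_one_adj A B : flag A -> flag B -> differ_in_one A B ->
  exists2 i, (i < n)%N & B = adj A i.
Proof.
move=> fA fB [F [H [AB BA]]].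
have [AF BF] : (A `\` B) F by rewrite AB.
have rF := rank_bounds F.
have rF1 : rank F <> -1 by move=> e; apply: BF; apply: flag_improper; auto.
have rFn : rank F <> n%:Z by move=> e; apply: BF; apply: flag_improper; auto.
have ltin : (`|rank F| < n)%N by lia.
exists `|rank F|%N => //; apply/esym/adj_eq => // [e|x Ax rx].
  by apply: BF; rewrite e.
apply: contrapT => Bx; have : (A `\` B) x by [].
by rewrite AB => xF; apply: rx; rewrite xF; lia.
Qed.

(** Flag-connectivity recast as an induction principle on adjacency. *)
Lemma flag_ind (Q : set (set P)) A : flag A -> Q A ->
  (forall B i, flag B -> Q B -> (i < n)%N -> Q (adj B i)) ->
  forall B, flag B -> Q B.
Proof.
move=> fA QA Qadj B fB.
have [k [C [C0 <- fC dC]]] := strongly_flag_connected fA fB.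
suff: forall i, (i <= k)%N -> Q (C i) by apply.
elim=> [_|i IH ik]; first by rewrite C0.
have [|fi _] := fC i; first by lia.
have [fi1 _] := fC i.+1 ik.
have [j jn ->] := differ_in_one_adj fi fi1 (dC _ ik).
by apply: Qadj => //; apply: IH; lia.
Qed.

(** * Automorphisms and dualities *)

Lemma aut_id : automorphism (1%g : sym P). Proof. by []. Qed.

Lemma autM g h : automorphism g -> automorphism h -> automorphism (g * h)%g.
Proof. by move=> ag ah x y /=; rewrite ah ag. Qed.

Lemma autV g : automorphism g -> automorphism g^-1%g.
Proof. by move=> ag x y /=; rewrite -ag !sym_invK. Qed.

Lemma dualV d : duality d -> duality d^-1%g.
Proof. by move=> dd x y /=; rewrite -dd !sym_invK. Qed.

Lemma dualM d d' : duality d -> duality d' -> automorphism (d * d')%g.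
Proof. by move=> dd dd' x y /=; rewrite dd' dd. Qed.

Lemma dual_autM d g : duality d -> automorphism g -> duality (d * g)%g.
Proof. by move=> dd ag x y /=; rewrite ag dd. Qed.

Lemma aut_dualM d g : duality d -> automorphism g -> duality (g * d)%g.
Proof. by move=> dd ag x y /=; rewrite dd ag. Qed.

Lemma sym_lt g : automorphism g -> {mono g : x y / (x < y)%O}.
Proof.
by move=> ag x y; rewrite !lt_def ag (inj_eq (can_inj (sym_funK g))).
Qed.

Lemma dual_lt d : duality d -> {mono d : x y /~ (x < y)%O}.
Proof.
by move=> dd x y; rewrite !lt_def dd (inj_eq (can_inj (sym_funK d))) eq_sym.
Qed.

Lemma lower_face x : rank x <> -1 -> exists2 y, (y < x)%O & rank y = rank x - 1.
Proof.
move=> rx; have [A fA Ax] := face_in_flag x; have rb := rank_bounds x.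
have [|y Ay ry] := @flag_face A (rank x - 1) fA; first by lia.
exists y => //; rewrite lt_neqAle; apply/andP; split.
  by apply/eqP => e; move: ry; rewrite e; lia.
by apply: (chain_le (flag_chain fA)); rewrite // ry; lia.
Qed.

Lemma upper_face x : rank x <> n%:Z ->
  exists2 y, (x < y)%O & rank y = rank x + 1.
Proof.
move=> rx; have [A fA Ax] := face_in_flag x; have rb := rank_bounds x.
have [|y Ay ry] := @flag_face A (rank x + 1) fA; first by lia.
exists y => //; rewrite lt_neqAle; apply/andP; split.
  by apply/eqP => e; move: ry; rewrite -e; lia.
by apply: (chain_le (flag_chain fA)); rewrite // ry; lia.
Qed.

Lemma face_ind (Q : P -> Prop) :
  (forall x, rank x = -1 -> Q x) ->
  (forall x y, (y < x)%O -> rank y = rank x - 1 -> Q y -> Q x) ->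
  forall x, Q x.
Proof.
move=> Q1 QS x; have [m e] : exists m : nat, rank x = m%:Z - 1.
  by exists (absz (rank x + 1)); have := rank_bounds x; lia.
elim: m x e => [|m IH] x e; first by apply: Q1; rewrite e.
have [|y yx ry] := @lower_face x; first by lia.
by apply: (QS _ _ yx ry); apply: IH; lia.
Qed.

(** Automorphisms are defined by the order alone, so ranks must be recovered: along a chain climbing
    from the least face to [x] rank by rank, the images gain at least one at each step. The inverse
    then gives equality. *)
Lemma aut_rank_le g x : automorphism g -> rank x <= rank (g x).
Proof.
move=> ag; elim/face_ind: x => [x ->|x y yx ry IH].
  by case/andP: (rank_bounds (g x)).
by have := rank_lt (etrans (sym_lt ag _ _) yx); lia.
Qed.

Lemma aut_rank g x : automorphism g -> rank (g x) = rank x.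
Proof.
move=> ag; apply/le_anti; rewrite aut_rank_le // andbT.
by have := aut_rank_le (g x) (autV ag); rewrite /= sym_funK.
Qed.

Lemma dual_rank_le d x : duality d -> rank (d x) <= n%:Z - 1 - rank x.
Proof.
move=> dd; elim/face_ind: x => [x ->|x y yx ry IH].
  by have := rank_bounds (d x); lia.
by have := rank_lt (etrans (dual_lt dd _ _) yx); lia.
Qed.

Lemma dual_rank_ge d x : duality d -> n%:Z - 1 - rank x <= rank (d x).
Proof.
move=> dd; have [m e] : exists m : nat, rank x = n%:Z - m%:Z.
  by exists (absz (n%:Z - rank x)); have := rank_bounds x; lia.
elim: m x e => [|m IH] x e; first by have := rank_bounds (d x); lia.
have [|y xy ry] := @upper_face x; first by lia.
by have := rank_lt (etrans (dual_lt dd _ _) xy); have := IH y; lia.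
Qed.

Lemma dual_rank d x : duality d -> rank (d x) = n%:Z - 1 - rank x.
Proof. by move=> dd; apply/le_anti; rewrite dual_rank_le ?dual_rank_ge. Qed.

(** The least face would be sent to a face of rank both -1 and n. *)
Lemma duality_not_aut d : duality d -> ~ automorphism d.
Proof.
move=> dd ad; have [x rx _] := least_face P.
by have := dual_rank x dd; rewrite aut_rank // rx; lia.
Qed.

Lemma ext_chain g A : extended_group g -> chain A -> chain (g @` A).
Proof.
move=> eg cA _ _ [x Ax <-] [y Ay <-].
by case: eg => eg; rewrite !eg; have [] := cA _ _ Ax Ay; auto.
Qed.

Lemma extV g : extended_group g -> extended_group (g^-1%g : sym P).
Proof. by case=> eg; [left; apply: autV | right; apply: dualV]. Qed.

Lemma image_sym1 A : (1%g : sym P) @` A = A. Proof. exact: image_id. Qed.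

Lemma image_symM g h A : (g * h)%g @` A = h @` (g @` A).
Proof. by rewrite image_comp. Qed.

Lemma image_symK g A : g^-1%g @` (g @` A) = A.
Proof. by rewrite -image_symM mulgV image_sym1. Qed.

Lemma image_symKV g A : g @` (g^-1%g @` A) = A.
Proof. by rewrite -image_symM mulVg image_sym1. Qed.

Lemma ext_flag g A : extended_group g -> flag A -> flag (g @` A).
Proof.
move=> eg [cA mA]; split; first exact: ext_chain.
move=> B cB AB; rewrite -[B](image_symKV g); congr (_ @` _).
apply: mA; first exact: ext_chain (extV eg) cB.
by rewrite -[A](image_symK g); apply: image_subset.
Qed.

Lemma aut_flag g A : automorphism g -> flag A -> flag (g @` A).
Proof. by move=> ag; apply: ext_flag; left. Qed.

Lemma image_sym_inj g A B : g @` A = g @` B -> A = B.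
Proof. by move=> e; rewrite -(image_symK g A) e image_symK. Qed.

Lemma aut_adj g A i : automorphism g -> (i < n)%N -> flag A ->
  g @` (adj A i) = adj (g @` A) i.
Proof.
move=> ag ltin fA; have [fi iA sA] := adj_spec ltin fA.
apply/esym/adj_eq => //; [exact: aut_flag..| |].
  by move=> /image_sym_inj.
by move=> _ [x Ax <-] rx; exists x => //; apply: sA => //;
  rewrite -(aut_rank x ag).
Qed.

Lemma aut_adj2 g A i j : automorphism g -> (i < n)%N -> (j < n)%N -> flag A ->
  g @` (adj (adj A i) j) = adj (adj (g @` A) i) j.
Proof. by move=> ag ltin jn fA; rewrite !aut_adj //; apply: adj_flag. Qed.

Lemma dual_adj d A i : duality d -> (i < n)%N -> flag A ->
  d @` (adj A i) = adj (d @` A) (n.-1 - i).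
Proof.
move=> dd ltin fA; have [fi iA sA] := adj_spec ltin fA.
have ed : extended_group d by right.
apply/esym/adj_eq => //; [lia|exact: ext_flag..| |].
  by move=> /image_sym_inj.
move=> _ [x Ax <-] rx; exists x => //; apply: sA => // e; apply: rx.
by rewrite (dual_rank x dd) e; lia.
Qed.

(** Agreement on one flag spreads over adjacent flags to all of them; a face is then recovered from
    a flag through its rank. *)
Lemma aut_flag_inj g h A : flag A -> automorphism g -> automorphism h ->
  g @` A = h @` A -> g = h.
Proof.
move=> fA ag ah e; apply: symP => x.
have [B fB Bx] := face_in_flag x.
have : g @` B = h @` B.
  apply: (flag_ind fA (Q := fun B => g @` B = h @` B)) fB => // C i fC IH ltin.
  by rewrite !aut_adj // IH.
move=> eB; apply: (chain_rank_inj (flag_chain (aut_flag ah fB))).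
- by rewrite -eB; exists x.
- by exists x.
- by rewrite !aut_rank.
Qed.

End Flags.

(** * String C-groups of rank 3 *)

Section StringC.
Local Open Scope group_scope.

(* The stabilizer of the base face of rank r - 1; it is the whole group both for
   r = 0 and for r = 4. *)
Definition parabolic (G : groupType) (t : nat -> G) (r : nat) : set G :=
  generated (t @` [set i | (i < 3)%N /\ i.+1 <> r]).

Lemma parabolic_ind (G : groupType) (t : nat -> G) (Q : set G) r :
  (forall i, (i < 3)%N -> t i * t i = 1) -> Q 1 ->
  (forall i g, (i < 3)%N -> i.+1 <> r -> Q g -> Q (t i * g)) ->
  parabolic t r `<=` Q.
Proof.
move=> tt Q1 QM; apply: generated_ind => // [_ g [i [i3 ir] <-]|_ g [i [i3 ir]
  <-]].
  exact: QM.
by rewrite (mulg1_eq (tt i i3)); apply: QM.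
Qed.

(* The remaining instances of the intersection property follow from
   [string_inter] and [string_irred]. *)
Record stringC (G : groupType) := StringC {
  string_gen :> nat -> G;
  string_sq : forall i, (i < 3)%N -> string_gen i * string_gen i = 1;
  string_comm : string_gen 0 * string_gen 2 = string_gen 2 * string_gen 0;
  string_irred : forall i, (i < 3)%N ->
    ~ parabolic string_gen i.+1 (string_gen i);
  string_inter : forall g,
    parabolic string_gen 1 g -> parabolic string_gen 3 g ->
    g = 1 \/ g = string_gen 1 }.

(* A face of rank [coset_rank - 1] is a right coset of a parabolic subgroup. *)
Record coset_face (G : groupType) (C : stringC G) := CosetFace {
  coset_rank : nat;
  coset_set :> G -> Prop;
  _ : (coset_rank < 5)%N;
  _ : exists g, parabolic C 0 g /\
        coset_set = [set h | parabolic C coset_rank (h * g^-1)] }.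

HB.instance Definition _ G (C : stringC G) := gen_eqMixin (coset_face C).
HB.instance Definition _ G (C : stringC G) := gen_choiceMixin (coset_face C).

Variables (G : groupType) (C : stringC G).
Implicit Types (g h k u : G) (x y z : coset_face C) (i r : nat).
Notation H := (parabolic C).
Notation rk := (@coset_rank G C).
Notation t := (string_gen C).

(** * Intersections of parabolic subgroups *)

Lemma string_genV i : (i < 3)%N -> (t i)^-1 = t i.
Proof. by move=> i3; apply: mulg1_eq; apply: string_sq. Qed.

Lemma parabolic1 r : H r 1. Proof. exact: generated1. Qed.

Lemma parabolicM r g h : H r g -> H r h -> H r (g * h).
Proof. exact: generatedM. Qed.

Lemma parabolicV r g : H r g -> H r g^-1.
Proof. exact: generatedV. Qed.

Lemma parabolic_gen r i : (i < 3)%N -> i.+1 <> r -> H r (t i).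
Proof. by move=> i3 ir; apply: mem_generated; exists i. Qed.

Lemma parabolic_sub0 r : H r `<=` H 0.
Proof. by apply: generatedS => _ [i [i3 _] <-]; exists i. Qed.

Lemma parabolic4 : H 4 = H 0.
Proof.
apply/seteqP; split; first exact: parabolic_sub0.
by apply: generatedS => _ [i [i3 _] <-]; exists i => //; split=> //; lia.
Qed.

Lemma parabolic_middle g : H 2 g ->
  exists c d, [/\ c = 1 \/ c = t 0, d = 1 \/ d = t 2 & g = c * d].
Proof.
move: g; apply: (@parabolic_ind _ t [set g | exists c d,
  [/\ c = 1 \/ c = t 0, d = 1 \/ d = t 2 & g = c * d]]).
  exact: string_sq.
  by exists 1, 1; rewrite mulg1; split; auto.
move=> i g i3 i1 [c [d [Hc Hd ->]]].
have [->|->] : i = 0%N \/ i = 2%N by lia.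
  exists (t 0 * c), d; rewrite mulgA; split=> //.
  by case: Hc => ->; rewrite ?mulg1 ?string_sq //; auto.
exists c, (t 2 * d); split=> //.
  by case: Hd => ->; rewrite ?mulg1 ?string_sq //; auto.
by case: Hc => ->; rewrite ?mul1g // !mulgA string_comm.
Qed.

Lemma parabolic_middle_lower g : H 1 g -> H 2 g -> g = 1 \/ g = t 2.
Proof.
move=> Hg /parabolic_middle[c [d [[->|->] Hd e]]]; rewrite e ?mul1g // in Hg *.
case: (@string_irred G C 0) => //; rewrite -[t 0](mulgK d);
  apply: parabolicM => //.
by apply: parabolicV; case: Hd => ->;
  [apply: parabolic1 | apply: parabolic_gen].
Qed.

Lemma parabolic_middle_upper g : H 3 g -> H 2 g -> g = 1 \/ g = t 0.
Proof.
move=> Hg /parabolic_middle[c [d [Hc [->|->] e]]]; rewrite e ?mulg1 // in Hg *.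
case: (@string_irred G C 2) => //; rewrite -[t 2](mulKg c);
  apply: parabolicM => //.
by apply: parabolicV; case: Hc => ->;
  [apply: parabolic1 | apply: parabolic_gen].
Qed.

(** The group form of strong flag-connectivity: [g] is a product of generators moving only faces not
    shared by the base flag and its image under [g]. If at most one of the three parabolics contains
    [g], the generators allowed are precisely its own, or all of them; otherwise the pairwise
    intersections leave 1 or a single generator. *)
Lemma parabolic_common g : H 0 g ->
  generated (t @` [set i | (i < 3)%N /\ ~ H i.+1 g]) g.
Proof.
move=> H0.
have sub r : (forall i, (i < 3)%N -> i.+1 <> r -> ~ H i.+1 g) -> H r g ->
    generated (t @` [set i | (i < 3)%N /\ ~ H i.+1 g]) g.
  move=> nH; apply: generatedS => _ [i [i3 ir] <-].
  by exists i => //; split=> //; apply: nH.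
have base i : (i < 3)%N -> ~ H i.+1 g -> g = 1 \/ g = t i ->
    generated (t @` [set i | (i < 3)%N /\ ~ H i.+1 g]) g.
  move=> i3 nH [->|gi]; first exact: generated1.
  by apply: mem_generated; exists i.
have [H1|H1] := pselect (H 1 g); have [H2|H2] := pselect (H 2 g);
have [H3|H3] := pselect (H 3 g).
- have [->|g1] := string_inter H1 H3; first exact: generated1.
  by case: (@string_irred G C 1) => //; rewrite -g1.
- by apply: (base 2) => //; apply: parabolic_middle_lower.
- by apply: (base 1%N) => //; apply: string_inter.
- by apply: (sub 1%N) => // -[|[|[|]]].
- by apply: (base 0) => //; apply: parabolic_middle_upper.
- by apply: (sub 2%N) => // -[|[|[|]]].
- by apply: (sub 3%N) => // -[|[|[|]]].
- by apply: (sub 0%N) => // -[|[|[|]]].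
Qed.

Lemma parabolic_trivial g : H 1 g -> H 2 g -> H 3 g -> g = 1.
Proof.
move=> H1 H2 H3; have [//|g1] := string_inter H1 H3.
by case: (@string_irred G C 1) => //; rewrite -g1.
Qed.

(** The group form of the diamond condition: up to left multiplication by [t r], an element fixing
    the base faces of ranks r - 1 and r + 1 also fixes the one of rank r. *)
Lemma parabolic_diamond r g : (r < 3)%N -> H r g -> H r.+2 g ->
  H r.+1 g \/ H r.+1 (t r * g).
Proof.
case: r => [|[|[|//]]] _ Hl Hu.
- have [c [d [Hc Hd ->]]] := parabolic_middle Hu.
  have H1d : H 1 d.
    by case: Hd => ->; [apply: parabolic1 | apply: parabolic_gen].
  case: Hc => ->; rewrite ?mul1g; first by left.
  by right; rewrite mulgA string_sq // mul1g.
- have [->|->] := string_inter Hl Hu; first by left; apply: parabolic1.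
  by right; rewrite string_sq //; apply: parabolic1.
- have [c [d [Hc Hd ->]]] := parabolic_middle Hl.
  have H3c : H 3 c.
    by case: Hc => ->; [apply: parabolic1 | apply: parabolic_gen].
  case: Hd => ->; rewrite ?mulg1; first by left.
  right; have -> : t 2 * (c * t 2) = c; last exact: H3c.
  case: Hc => ->; first by rewrite mul1g string_sq.
  by rewrite string_comm mulgA string_sq // mul1g.
Qed.

(** * The coset polytope *)

Lemma coset_rank_lt x : (rk x < 5)%N. Proof. by case: x. Qed.

Lemma coset_mem_base x :
  exists u, H 0 u /\ forall h, x h <-> H (rk x) (h * u^-1).
Proof.
by case: x => r X r5 [u [Hu e]]; exists u; split=> // h /=; rewrite e.
Qed.

Lemma coset_memP x g h : x g -> (x h <-> H (rk x) (h * g^-1)).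
Proof.
have [u [Hu xP]] := coset_mem_base x; rewrite !xP => Hg; split=> Hh.
  by rewrite -(mulgKA u^-1); apply: parabolicM => //; apply: parabolicV.
by rewrite -(divgKA g); apply: parabolicM.
Qed.

Lemma coset_mem_parabolic0 x g : x g -> H 0 g.
Proof.
have [u [Hu ->]] := coset_mem_base x => Hg.
by rewrite -(mulgVK u g); apply: parabolicM => //; apply: parabolic_sub0 Hg.
Qed.

Lemma coset_mem_ex x : exists g, x g.
Proof.
have [u [Hu xP]] := coset_mem_base x.
by exists u; rewrite xP mulgV; apply: parabolic1.
Qed.

Lemma coset_face_ex r g : (r < 5)%N -> H 0 g -> exists x, rk x = r /\ x g.
Proof.
move=> r5 Hg; have ex
  : exists u, H 0 u /\ [set h | H r (h * g^-1)] =
    [set h | H r (h * u^-1)] by exists g.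
by exists (CosetFace r5 ex); split; rewrite //= mulgV; apply: parabolic1.
Qed.

Lemma coset_face_uniq x y g : rk x = rk y -> x g -> y g -> x = y.
Proof.
move=> e xg yg.
have : x = y :> (G -> Prop).
  by apply/funext => h; apply/propext;
    rewrite (coset_memP h xg) (coset_memP h yg) e.
case: x y e {xg yg} => [r X r5 eX] [r' Y r5' eY] /= e e'; subst r' Y.
by rewrite (Prop_irrelevance r5 r5') (Prop_irrelevance eX eY).
Qed.

Lemma coset_mem_improper x g : rk x = 0 \/ rk x = 4 -> H 0 g -> x g.
Proof.
move=> rx Hg; have [h xh] := coset_mem_ex x.
apply/(coset_memP g xh); have Hh := coset_mem_parabolic0 xh.
suff -> : H (rk x) = H 0 by apply: parabolicM => //; apply: parabolicV.
by case: rx => ->; rewrite ?parabolic4.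
Qed.

(** With h = c d g, where c is 1 or [t 0] and d is 1 or [t 2], the element d g serves: d fixes the
    base vertex and the base edge, and c fixes the base 2-face. *)
Lemma coset_middle x y z g h : rk x = 1%N -> rk y = 2 -> rk z = 3 ->
  x g -> y g -> y h -> z h -> exists u, [/\ x u, y u & z u].
Proof.
move=> rx ry rz xg yg yh zh.
have := (coset_memP h yg).1 yh;
  rewrite ry => /parabolic_middle[c [d [Hc Hd e]]].
have h2 : h = c * (d * g) by rewrite mulgA -e mulgVK.
exists (d * g); split.
- apply/(coset_memP _ xg); rewrite mulgK rx.
  by case: Hd => ->; [apply: parabolic1 | apply: parabolic_gen].
- apply/(coset_memP _ yg); rewrite mulgK ry.
  by case: Hd => ->; [apply: parabolic1 | apply: parabolic_gen].
- apply/(coset_memP _ zh); rewrite h2 invgM mulVKg rz.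
  by apply: parabolicV; case: Hc => ->;
    [apply: parabolic1 | apply: parabolic_gen].
Qed.

Definition coset_le x y := `[< (rk x <= rk y)%N /\ exists g, x g /\ y g >].

Lemma coset_le_refl : reflexive coset_le.
Proof.
by move=> x; apply/asboolP; split=> //; have [g xg] := coset_mem_ex x; exists g.
Qed.

Lemma coset_le_anti : antisymmetric coset_le.
Proof.
move=> x y /andP[/asboolP[xy [g [xg yg]]] /asboolP[yx _]].
by apply: coset_face_uniq xg yg; apply/eqP; rewrite eqn_leq xy.
Qed.

(** Faces of equal rank that meet coincide and improper faces are the whole group, so only a vertex,
    an edge and a 2-face need an argument. *)
Lemma coset_le_trans : transitive coset_le.
Proof.
move=> y x z /asboolP[xy [g [xg yg]]] /asboolP[yz [h [yh zh]]].
apply/asboolP; split; first exact: leq_trans xy yz.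
have z4 := coset_rank_lt z.
have [e|nxy] := eqVneq (rk x) (rk y).
  by rewrite (coset_face_uniq e xg yg); exists h.
have [e|nyz] := eqVneq (rk y) (rk z).
  by rewrite -(coset_face_uniq e yh zh); exists g.
have [x0|x0] := eqVneq (rk x) 0.
  exists h; split=> //; apply: coset_mem_improper; first by left.
  exact: coset_mem_parabolic0 yh.
have [z0|z0] := eqVneq (rk z) 4.
  exists g; split=> //; apply: coset_mem_improper; first by right.
  exact: coset_mem_parabolic0 yg.
have [|||u [xu _ zu]] := coset_middle _ _ _ xg yg yh zh; try lia.
by exists u.
Qed.

End StringC.

Fact coset_display : Order.disp_t. Proof. exact: Order.Disp tt tt. Qed.

HB.instance Definition _ (G : groupType) (C : stringC G) :=
  Order.Le_isPOrder.Build coset_display (coset_face C)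
    (@coset_le_refl G C) (@coset_le_anti G C) (@coset_le_trans G C).

(** * Flags and flag-connectivity of the coset polytope *)

Section CosetPolytope.
Local Open Scope group_scope.
Variables (G : groupType) (C : stringC G).
Implicit Types (g h k u : G) (x y z : coset_face C) (i r : nat).
Implicit Types (A B : set (coset_face C)).
Notation H := (parabolic C).
Notation rk := (@coset_rank G C).
Notation t := (string_gen C).

Lemma coset_leP x y :
  (x <= y)%O <-> (rk x <= rk y)%N /\ exists g, x g /\ y g.
Proof. by split=> [/asboolP|?]; [|apply/asboolP]. Qed.

(** The image of the base flag under right multiplication by [g]; it is empty for [g] outside
    [H 0]. *)
Definition coset_flag g : set (coset_face C) := [set x | x g].

Lemma coset_chain_pair A r r' : chain A ->
  exists g, H 0 g /\ forall x, A x -> rk x = r \/ rk x = r' -> x g.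
Proof.
move=> cA; have uniq x y : A x -> A y -> rk x = rk y -> x = y.
  by move=> Ax Ay e; have [/coset_leP|/coset_leP] := cA _ _ Ax Ay;
    move=> [_ [g [? ?]]]; apply: (@coset_face_uniq _ _ _ _ g).
have [[x [Ax rx]]|nx] := pselect (exists x, A x /\ rk x = r);
have [[y [Ay ry]]|ny] := pselect (exists y, A y /\ rk y = r').
- have [g [xg yg]] : exists g, x g /\ y g.
    by have [/coset_leP|/coset_leP] := cA _ _ Ax Ay; move=> [_ [g [? ?]]];
      exists g.
  exists g; split; first exact: coset_mem_parabolic0 xg.
  by move=> z Az [rz|rz]; [rewrite (uniq z x) ?rz | rewrite (uniq z y) ?rz].
- have [g xg] := coset_mem_ex x; exists g; split;
    first exact: coset_mem_parabolic0 xg.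
  move=> z Az [rz|rz]; first by rewrite (uniq z x) ?rz.
  by case: ny; exists z.
- have [g xg] := coset_mem_ex y; exists g; split;
    first exact: coset_mem_parabolic0 xg.
  move=> z Az [rz|rz]; last by rewrite (uniq z y) ?rz.
  by case: nx; exists z.
- exists 1; split; first exact: parabolic1.
  by move=> z Az [rz|rz]; [case: nx | case: ny]; exists z.
Qed.

(** Pairwise incidence must be turned into one element common to all cosets. A vertex and a 2-face
    share one directly; if an edge is present, [coset_middle] merges an element for vertex and edge
    with one for edge and 2-face. *)
Lemma coset_chain_flag A : chain A ->
  exists g, H 0 g /\ A `<=` coset_flag g.
Proof.
move=> cA.
suff [g [Hg Ag]] : exists g, H 0 g /\
    forall x, A x -> (0 < rk x < 4)%N -> x g.
  exists g; split=> // x Ax; have x4 := coset_rank_lt x.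
  have [|] := boolP (0 < rk x < 4)%N; first exact: Ag.
  by move=> rx; apply: coset_mem_improper => //; lia.
have [[y [Ay ry]]|ny] := pselect (exists y, A y /\ rk y = 2); last first.
  have [g [Hg Ag]] := coset_chain_pair 1%N 3 cA; exists g; split=> // x Ax rx.
  apply: Ag => //; have : rk x <> 2 by move=> e; apply: ny; exists x.
  by lia.
have [g [Hg Ag]] := coset_chain_pair 1%N 2 cA.
have [h [Hh Ah]] := coset_chain_pair 3 2 cA.
have yg := Ag _ Ay (or_intror ry); have yh := Ah _ Ay (or_intror ry).
have [x [rx xg]] := @coset_face_ex _ C 1%N g isT Hg.
have [z [rz zh]] := @coset_face_ex _ C 3 h isT Hh.
have [u [xu yu zu]] := coset_middle rx ry rz xg yg yh zh.
exists u; split=> [|v Av rv]; first exact: coset_mem_parabolic0 xu.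
have [e|[e|e]] : rk v = 1%N \/ rk v = 2 \/ rk v = 3 by lia.
- by rewrite (@coset_face_uniq _ _ v x g) ?e //; apply: Ag => //; left.
- by rewrite (@coset_face_uniq _ _ v y g) ?e //; apply: Ag => //; right.
- by rewrite (@coset_face_uniq _ _ v z h) ?e //; apply: Ah => //; left.
Qed.

Lemma coset_flag_chain g : chain (coset_flag g).
Proof.
move=> x y xg yg; have [xy|yx] := leqP (rk x) (rk y); [left|right].
  by apply/coset_leP; split=> //; exists g.
by apply/coset_leP; split; [apply: ltnW | exists g].
Qed.

Lemma coset_flag_sub g h : H 0 g -> coset_flag g `<=` coset_flag h ->
  coset_flag h = coset_flag g.
Proof.
move=> Hg gh; apply/seteqP; split=> // x xh.
have [y [ry yg]] := coset_face_ex (coset_rank_lt x) Hg.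
by rewrite /coset_flag /= -(coset_face_uniq ry (gh _ yg) xh).
Qed.

Lemma coset_flagP A : flag A <-> exists g, H 0 g /\ A = coset_flag g.
Proof.
split=> [[cA mA]|[g [Hg ->]]].
  have [g [Hg Ag]] := coset_chain_flag cA; exists g; split=> //.
  by rewrite (mA _ (@coset_flag_chain g) Ag).
split=> [|B cB gB]; first exact: coset_flag_chain.
have [h [Hh Bh]] := coset_chain_flag cB.
have hg := coset_flag_sub Hg (subset_trans gB Bh).
by apply/seteqP; split=> //; rewrite -hg.
Qed.

Lemma coset_flag_parabolic x g h : x g -> x h -> H (rk x) (h * g^-1).
Proof. by move=> xg /(coset_memP _ xg). Qed.

Lemma coset_flag_gen x g i : (i < 3)%N -> rk x <> i.+1 -> x g -> x (t i * g).
Proof.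
move=> i3 rx xg; apply/(coset_memP _ xg); rewrite mulgK.
by apply: parabolic_gen => // e; apply: rx.
Qed.

Lemma coset_flag_gen_new x g i : (i < 3)%N -> rk x = i.+1 -> x g ->
  ~ x (t i * g).
Proof.
by move=> i3 rx xg /(coset_memP _ xg); rewrite mulgK rx; apply: string_irred.
Qed.

Lemma coset_flag_diff g i : (i < 3)%N -> H 0 g ->
  exists2 x, rk x = i.+1 & coset_flag g `\` coset_flag (t i * g) = [set x].
Proof.
move=> i3 Hg; have [|x [rx xg]] := @coset_face_ex _ C i.+1 g _ Hg; first by lia.
exists x => //; apply/seteqP; split=> [y [yg ytg]|_ ->].
  apply: (@coset_face_uniq _ _ y x g) => //; rewrite rx.
  by apply: contrapT => ry; apply: ytg; apply: coset_flag_gen.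
by split=> //; apply: coset_flag_gen_new.
Qed.

Lemma parabolic0_genM g i : (i < 3)%N -> H 0 g -> H 0 (t i * g).
Proof. by move=> i3; apply: parabolicM; apply: parabolic_gen. Qed.

Lemma string_genK g i : (i < 3)%N -> t i * (t i * g) = g.
Proof. by move=> i3; rewrite mulgA string_sq // mul1g. Qed.

Lemma coset_flag_is_flag g : H 0 g -> flag (coset_flag g).
Proof. by move=> Hg; apply/coset_flagP; exists g. Qed.

Lemma coset_flag_differ g i : (i < 3)%N -> H 0 g ->
  differ_in_one (coset_flag g) (coset_flag (t i * g)).
Proof.
move=> i3 Hg; have [x _ xE] := coset_flag_diff i3 Hg.
have [y _ yE] := coset_flag_diff i3 (parabolic0_genM i3 Hg).
by exists x, y; split=> //; rewrite string_genK in yE.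
Qed.

Lemma coset_connected (A B : set (coset_face C)) : flag A -> flag B ->
  exists (m : nat) (D : nat -> set (coset_face C)),
    [/\ D 0%N = A, D m = B,
        forall i, (i <= m)%N -> flag (D i) /\ A `&` B `<=` D i &
        forall i, (i < m)%N -> differ_in_one (D i) (D i.+1)].
Proof.
move=> /coset_flagP[g [Hg ->]] /coset_flagP[h [Hh ->]].
(* The faces common to both flags are those whose parabolic contains [k], so a word for [k] given by
   [parabolic_common] leaves them untouched at each step. *)
pose k := h * g^-1.
have hE : h = k * g by rewrite mulgVK.
have Hk : H 0 k by apply: parabolicM => //; apply: parabolicV.
pose AB := coset_flag g `&` coset_flag h.
pose Q : set G := [set u | H 0 u /\ exists (m : nat) D,
   [/\ D 0%N = coset_flag g, D m = coset_flag (u * g),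
        forall i, (i <= m)%N -> flag (D i) /\ AB `<=` D i &
        forall i, (i < m)%N -> differ_in_one (D i) (D i.+1)]].
suff : Q k by case=> _; rewrite -hE.
have QM i u : (i < 3)%N -> ~ H i.+1 k -> Q u -> Q (t i * u).
  move=> i3 nH [Hu [m [D [D0 Dm fD dD]]]]; split; first exact: parabolic0_genM.
  have Hug : H 0 (u * g) by apply: parabolicM.
  exists m.+1, (fun j => if (j <= m)%N then D j else coset_flag (t i * (u *
    g))).
  split=> //; first by rewrite ltnn mulgA.
  - move=> j; rewrite leq_eqVlt => /predU1P[->|];
      last by rewrite ltnS => jm; rewrite jm; apply: fD.
    rewrite ltnn; split; first by apply: coset_flag_is_flag;
      apply: parabolic0_genM.
    move=> x [xg xh]; apply: coset_flag_gen => //.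
      by move=> rx; apply: nH; rewrite -rx; apply: coset_flag_parabolic.
    by have [_ /(_ x (conj xg xh))] := fD m (leqnn m); rewrite Dm.
  - move=> j; rewrite ltnS => jm; rewrite jm.
    move: jm; rewrite leq_eqVlt => /predU1P[->|jm].
      by rewrite ltnn Dm; apply: coset_flag_differ.
    by rewrite jm; apply: dD.
apply: generated_ind (parabolic_common Hk) => [|_ u [i [i3 nH] <-]|_ u [i [i3
  nH] <-]].
- split; first exact: parabolic1.
  exists 0%N, (fun=> coset_flag g); split=> // [|i _]; first by rewrite mul1g.
  by split; [apply: coset_flag_is_flag | move=> x []].
- exact: QM.
- by rewrite string_genV //; apply: QM.
Qed.

(** * Rank function and remaining polytope axioms *)

Definition coset_face_rank x : int := ((rk x)%:Z - 1)%R.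

Lemma coset_face_rank_lt x y : (x < y)%O ->
  (coset_face_rank x < coset_face_rank y)%R.
Proof.
rewrite lt_def => /andP[/eqP yx /coset_leP[xy [g [xg yg]]]].
have : rk x <> rk y by move=> e; apply: yx; rewrite (coset_face_uniq e xg yg).
by rewrite /coset_face_rank; lia.
Qed.

Lemma coset_face_rank_range :
  range coset_face_rank = [set r : int | -1 <= r <= 3%:Z]%R.
Proof.
apply/seteqP; split=> [_ [x _ <-]|r /= r3].
  by have := coset_rank_lt x; rewrite /coset_face_rank /=; lia.
have [|x [rx _]] := @coset_face_ex _ C (absz (r + 1)%R) 1 _ (@parabolic1 _ C
  0); first by lia.
by exists x => //; rewrite /coset_face_rank rx; lia.
Qed.

Lemma coset_least : exists2 x, coset_face_rank x =
  (-1)%R & forall y, (x <= y)%O.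
Proof.
have [x [rx _]] := @coset_face_ex _ C 0 1 isT (@parabolic1 _ C 0).
exists x => [|y]; first by rewrite /coset_face_rank rx.
apply/coset_leP; rewrite rx; split=> //; have [g yg] := coset_mem_ex y.
exists g; split=> //; apply: coset_mem_improper; first by left.
exact: coset_mem_parabolic0 yg.
Qed.

Lemma coset_greatest
  : exists2 x, coset_face_rank x = 3%:Z%R & forall y, (y <= x)%O.
Proof.
have [x [rx _]] := @coset_face_ex _ C 4 1 isT (@parabolic1 _ C 0).
exists x => [|y]; first by rewrite /coset_face_rank rx.
apply/coset_leP; rewrite rx; split; first by have := coset_rank_lt y.
have [g yg] := coset_mem_ex y.
exists g; split=> //; apply: coset_mem_improper; first by right.
exact: coset_mem_parabolic0 yg.
Qed.

Lemma coset_flag_card A : flag A -> (A #= `I_5)%card.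
Proof.
move=> /coset_flagP[g [Hg ->]].
have rI : {in coset_flag g &, injective rk}.
  by move=> x y /set_mem xg /set_mem yg e; apply: coset_face_uniq e xg yg.
rewrite -(card_eql (inj_card_eq rI)).
suff -> : rk @` coset_flag g = `I_5 by [].
apply/seteqP; split=> [_ [x _ <-]|r r5]; first exact: coset_rank_lt.
by have [x [rx xg]] := @coset_face_ex _ C r g r5 Hg; exists x.
Qed.

Lemma coset_diamond (j : int) x y : (x <= y)%O ->
  coset_face_rank x = (j - 1)%R -> coset_face_rank y = (j + 1)%R ->
  ([set z | section x y z /\ coset_face_rank z = j] #= `I_2)%card.
Proof.
move=> /coset_leP[_ [g [xg yg]]] rx ry; have x4 := coset_rank_lt x.
have y4 := coset_rank_lt y; have Hg := coset_mem_parabolic0 xg.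
rewrite /coset_face_rank in rx ry *.
have [r r3 jr] : exists2 r : nat, (r < 3)%N & j = Posz r by exists (rk x); lia.
subst j; have {}rx : rk x = r by lia.
have {}ry : rk y = r.+2 by lia.
(* The two faces in between belong to the flag of [g] and to its neighbour, the flag of [t r * g];
   their index is r + 1 because indices exceed ranks by one. *)
have [a [ra ag]] := @coset_face_ex _ C r.+1 g (leqW r3) Hg.
have [b [rb bg]] := @coset_face_ex _ C r.+1 (t r * g) (leqW r3)
  (parabolic0_genM r3 Hg).
have xtg : x (t r * g) by apply: coset_flag_gen => //; lia.
have ytg : y (t r * g) by apply: coset_flag_gen => //; lia.
apply/card_II2P; exists a, b; split.
  by move=> ab; apply: (coset_flag_gen_new r3 ra ag); rewrite ab.
apply/seteqP; split=> [z [[xz zy] rz]|_ [->|->]]; last 2 first.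
- split; last by lia.
  by split; apply/coset_leP; (split; [lia | by exists g]).
- split; last by lia.
  by split; apply/coset_leP; (split; [lia | by exists (t r * g)]).
have {}rz : rk z = r.+1 by lia.
have [u [Hu xyzu]] : exists u, H 0 u /\ [set w | [\/ w = x, w = z | w =
  y]] `<=` coset_flag u.
  apply: coset_chain_flag => v w [->|->|->] [->|->|->]; rewrite ?lexx; auto.
    by left; apply: le_trans zy.
  by right; apply: le_trans zy.
have [xu zu yu] : [/\ x u, z u & y u] by split; apply: xyzu;
  [apply: Or31|apply: Or32|apply: Or33].
have Hx := coset_flag_parabolic xu xg; have Hy := coset_flag_parabolic yu yg.
rewrite rx in Hx; rewrite ry in Hy.
have [Hz|Hz] := parabolic_diamond r3 Hx Hy; [left|right].
  apply: (@coset_face_uniq _ _ _ _ g) => //; first by rewrite rz.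
  by apply/(coset_memP _ zu); rewrite rz.
apply: (@coset_face_uniq _ _ _ _ (t r * g)) => //; first by rewrite rz.
by apply/(coset_memP _ zu); rewrite rz -mulgA.
Qed.

Definition coset_polytope : polytope 3 :=
  Polytope coset_face_rank_lt coset_face_rank_range coset_least coset_greatest
    coset_flag_card coset_connected coset_diamond.

(** * The automorphism group of the coset polytope *)

(** Right multiplication of cosets by [g], given as a relation: rank and one element determine the
    image. *)
Definition translates (a : sym (coset_face C)) g :=
  forall x, rk (a x) = rk x /\ forall h, x h -> a x (h * g).

(** The axiom of choice provides maps for [g] and for its inverse; they are mutually inverse because
    cosets of one rank sharing an element coincide. *)
Lemma translates_ex : forall g, H 0 g -> exists a, translates a g.
Proof.
have right_mul g : H 0 g -> {f : coset_face C -> coset_face C &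
    forall x, rk (f x) = rk x /\ forall h, x h -> f x (h * g)}.
  move=> Hg; apply: (@choice _ _
    (fun x y => rk y = rk x /\ forall h, x h -> y (h * g))) => x;
      have [u xu] := coset_mem_ex x.
  have Hu := coset_mem_parabolic0 xu.
  have [y [ry yug]] := coset_face_ex (coset_rank_lt x) (parabolicM Hu Hg).
  exists y; split=> // h xh; apply/(coset_memP _ yug).
  by rewrite mulgKA ry; apply: coset_flag_parabolic.
have inv g' f f' : (forall x, rk (f x) = rk x /\ forall h, x h ->
  f x (h * g')) ->
    (forall x, rk (f' x) = rk x /\ forall h, x h -> f' x (h * g'^-1)) ->
      cancel f f'.
  move=> fP f'P x; have [u xu] := coset_mem_ex x.
  apply: (@coset_face_uniq _ _ _ _ u) => //;
    first by rewrite (f'P _).1 (fP _).1.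
  by rewrite -(mulgK g' u); apply: (f'P _).2; apply: (fP _).2.
move=> g Hg; have [f fP] := right_mul g Hg;
  have [f' f'P] := right_mul _ (parabolicV Hg).
have fK := inv _ _ _ fP f'P.
have f'K : cancel f' f by apply: (inv g^-1) => //; rewrite invgK.
by exists (Sym fK f'K).
Qed.

Lemma translatesM a b g h :
  translates a g -> translates b h -> translates (a * b) (g * h).
Proof.
move=> ag bh x; split=> [|u xu] /=; first by rewrite (bh _).1 (ag _).1.
by rewrite mulgA; apply: (bh _).2; apply: (ag _).2.
Qed.

Lemma translatesV a g : translates a g -> translates a^-1 g^-1.
Proof.
move=> ag x; have rx : rk (a^-1 x) = rk x.
  by rewrite -[in RHS](sym_invK a x) (ag _).1.
split=> // h xh; have [u xu] := coset_mem_ex (a^-1 x).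
have := (ag _).2 _ xu; rewrite /= sym_invK => xug.
apply/(coset_memP _ xu); rewrite rx -mulgA -invgM.
exact: coset_flag_parabolic xug xh.
Qed.

Lemma translates_inj a b g : translates a g -> translates b g -> a = b.
Proof.
move=> ag bg; apply: symP => x; have [u xu] := coset_mem_ex x.
apply: (@coset_face_uniq _ _ _ _ (u * g)); first by rewrite (ag _).1 (bg _).1.
  exact: (ag _).2.
exact: (bg _).2.
Qed.

Lemma translates_aut a g : translates a g -> @automorphism 3 coset_polytope a.
Proof.
move=> ag.
have le b h x y : translates b h -> (x <= y)%O -> (b x <= b y)%O.
  move=> bh /coset_leP[xy [u [xu yu]]]; apply/coset_leP.
  rewrite !(bh _).1; split=> //; exists (u * h).
  by split; apply: (bh _).2.
move=> x y; apply/idP/idP; last exact: le ag.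
by move=> /(le _ _ _ _ (translatesV ag)); rewrite /= !sym_funK.
Qed.

Lemma translates_flag a g h : translates a g ->
  a @` coset_flag h = coset_flag (h * g).
Proof.
move=> ag; apply/seteqP; split=> [_ [x xh <-]|x xhg]; first exact: (ag _).2.
exists (a^-1 x); last by rewrite /= sym_invK.
by have := (translatesV ag x).2 _ xhg; rewrite mulgK.
Qed.

Definition translation g : sym (coset_face C) :=
  xget 1 [set a | translates a g].

Lemma translationP g : H 0 g -> translates (translation g) g.
Proof.
by move=> Hg; apply: (@xgetPex _ 1 [set a | translates a g]);
  apply: translates_ex.
Qed.

Lemma translationM g h : H 0 g -> H 0 h ->
  translation (g * h) = translation g * translation h.
Proof.
move=> Hg Hh; apply: translates_inj (translationP (parabolicM Hg Hh)) _.
by apply: translatesM; apply: translationP.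
Qed.

Lemma coset_flag_inj g h : H 0 g -> H 0 h -> coset_flag g = coset_flag h ->
  g = h.
Proof.
move=> Hg Hh e.
have key r : (r < 5)%N -> H r (g * h^-1).
  move=> r5; have [x [rx xh]] := coset_face_ex r5 Hh.
  have xg : coset_flag g x by rewrite e.
  by rewrite -rx; apply: coset_flag_parabolic.
by apply: divg1_eq; apply: parabolic_trivial; apply: key.
Qed.

Lemma translation_inj g h : H 0 g -> H 0 h ->
  translation g = translation h -> g = h.
Proof.
move=> Hg Hh e; apply: coset_flag_inj => //.
rewrite -[g]mul1g -[h]mul1g -(translates_flag _ (translationP Hg)) e.
exact: translates_flag (translationP Hh).
Qed.

(** Surjective because translations reach every flag and an automorphism is determined by its image
    of the base flag. *)
Lemma translation_iso : isomorphic (H 0) (@automorphism 3 coset_polytope).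
Proof.
exists translation; split; last exact: translationM.
split=> [g Hg|g h /set_mem Hg /set_mem Hh|a aa].
- exact: translates_aut (translationP Hg).
- exact: translation_inj.
have f1 := coset_flag_is_flag (@parabolic1 _ C 0).
have /coset_flagP[g [Hg ag]] := @aut_flag 3 coset_polytope _ _ aa f1.
exists g => //; apply: (@aut_flag_inj 3 coset_polytope _ _ _ f1 _ aa).
  exact: translates_aut (translationP Hg).
by rewrite ag (translates_flag _ (translationP Hg)) mul1g.
Qed.

Lemma coset_polytope_regular : regular coset_polytope.
Proof.
move=> _ _ /coset_flagP[g [Hg ->]] /coset_flagP[h [Hh ->]].
have /translationP gh : H 0 (g^-1 * h) by apply: parabolicM => //;
  apply: parabolicV.
exists (translation (g^-1 * h)); first exact: translates_aut gh.
by rewrite (translates_flag _ gh) mulVKg.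
Qed.

Lemma translation_has_order g m : H 0 g ->
  has_order g m -> has_order (translation g) m.
Proof.
move=> Hg gm k; rewrite -gm.
have H0k : H 0 (g ^+ k).
  by elim: k => [|k IH]; rewrite ?expg0 ?expgS;
    [apply: parabolic1 | apply: parabolicM].
have t1 : translation 1 = 1.
  apply: translates_inj (translationP (@parabolic1 _ C 0)) _ => x.
  by split=> // h; rewrite mulg1.
have -> : translation g ^+ k = translation (g ^+ k).
  elim: k H0k => [_|k IH H0k]; first by rewrite !expg0 t1.
  have H0k' : H 0 (g ^+ k).
    by rewrite -(mulKg g (g ^+ k)) -expgS; apply: parabolicM => //;
      apply: parabolicV.
  by rewrite !expgS IH // translationM.
split=> [e|->//]; apply: translation_inj => //; first exact: parabolic1.
by rewrite e t1.
Qed.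

Lemma coset_polytope_generators :
  @regular_generators 3 coset_polytope (coset_flag 1) (fun i => translation (t
    i)).
Proof.
split=> [|i i3]; first exact: coset_flag_is_flag (@parabolic1 _ C 0).
have Hi : H 0 (t i) by apply: parabolic_gen.
have ti := translationP Hi; split; first exact: translates_aut ti.
rewrite (translates_flag _ ti) mul1g; apply/esym.
apply: (@adj_eq 3 coset_polytope) => //.
- exact: coset_flag_is_flag (@parabolic1 _ C 0).
- exact: coset_flag_is_flag.
- move=> /(coset_flag_inj Hi (@parabolic1 _ C 0)) e;
    apply: (@string_irred _ C i) => //.
  by rewrite e; apply: parabolic1.
- move=> x x1 rx; rewrite -[t i]mulg1; apply: coset_flag_gen => //.
  by move=> e; apply: rx; rewrite /= /coset_face_rank e; lia.
Qed.

Lemma coset_polytope_type p q :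
  has_order (t 0 * t 1%N) p -> has_order (t 1%N * t 2) q ->
  regular_of_type coset_polytope [:: p; q].
Proof.
move=> tp tq; split=> //; first exact: coset_polytope_regular.
exists (coset_flag 1), (fun i => translation (t i)).
split=> [|i i2]; first exact: coset_polytope_generators.
have Hi j : (j < 3)%N -> H 0 (t j) by move=> j3; apply: parabolic_gen.
rewrite -translationM; [|apply: Hi; lia..].
apply: translation_has_order; first by apply: parabolicM; apply: Hi; lia.
by case: i i2 => [|[|]].
Qed.

End CosetPolytope.
(** * Flag orbits of the rotation group *)

Section RotationOrbits.
Variables (n : nat) (P : polytope n) (Phi : set P) (s : nat -> sym P).
Implicit Types (A B : set P) (g : sym P) (i : nat).
Local Open Scope group_scope.
Hypothesis fPhi : flag Phi.
Hypothesis n_gt0 : (0 < n)%N.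
Hypothesis s_aut : forall i, (0 < i < n)%N -> automorphism (s i).
Hypothesis s_Phi : forall i, (0 < i < n)%N -> s i @` Phi = adj (adj Phi i) i.-1.

Section Subgroup.
Variable S : set (sym P).
Hypothesis S_group : subgroup S.
Hypothesis S_aut : S `<=` @automorphism n P.
Hypothesis S_s : forall i, (0 < i < n)%N -> S (s i).

Let orbit A := exists2 g, S g & A = g @` Phi.

(** If Phi g = A^{i+1}, then Phi s_{i+1} g = A^{i+1,i+1,i} = A^i; the converse uses the inverse of
    s_{i+1}, which maps Phi to Phi^{i,i+1}. *)
Lemma orbit_adjS A i : (i.+1 < n)%N -> flag A ->
  orbit (adj A i.+1) <-> orbit (adj A i).
Proof.
move=> i1n fA; have ltin : (i < n)%N by apply: ltnW.
have [S1 SM SV] := S_group.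
have si : (0 < i.+1 < n)%N by [].
split=> -[g Sg e].
  exists (s i.+1 * g); first by apply: SM => //; apply: S_s.
  rewrite image_symM s_Phi //= aut_adj2 //; last exact: S_aut.
  by rewrite -e adjK.
exists ((s i.+1)^-1 * g); first by apply: SM => //; apply: SV; apply: S_s.
rewrite image_symM.
have -> : (s i.+1)^-1%g @` Phi = adj (adj Phi i) i.+1.
  apply: (@image_sym_inj _ _ (s i.+1)); rewrite image_symKV.
  rewrite aut_adj2 //; last exact: s_aut.
  by rewrite s_Phi //= !adjK //; apply: adj_flag.
rewrite aut_adj2 //; last exact: S_aut.
by rewrite -e adjK.
Qed.

Lemma orbit_adj A i j : (i < n)%N -> (j < n)%N -> flag A ->
  orbit (adj A i) -> orbit (adj A j).
Proof.
move=> ltin jn fA.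
have key k : (k < n)%N -> orbit (adj A k) <-> orbit (adj A 0).
  elim: k => [//|k IH kn]; rewrite -IH; last exact: ltnW.
  exact: orbit_adjS.
by rewrite !key.
Qed.

(** By [orbit_adj] it does not matter in which rank a neighbour is taken, so each adjacency swaps
    the two alternatives. *)
Lemma flag_orbits A : flag A -> orbit A \/ orbit (adj A 0).
Proof.
have [S1 _ _] := S_group.
apply: (@flag_ind _ _ (fun A => orbit A \/ orbit (adj A 0)) Phi fPhi).
  by left; exists 1 => //; rewrite image_sym1.
move=> B i fB [oB|oB] ltin; [right|left].
  by apply: (@orbit_adj _ i) => //; [apply: adj_flag | rewrite adjK].
exact: (@orbit_adj _ 0%N).
Qed.

End Subgroup.

Lemma aut_subgroup : subgroup (@automorphism n P).
Proof. by split; [apply: aut_id | apply: autM | apply: autV]. Qed.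

(** The criterion for contradicting chirality: Phi^0 then joins the orbit of Phi, so both
    alternatives of [flag_orbits] give a flag of that orbit. *)
Lemma regular_of_adj i g : (i < n)%N -> automorphism g ->
  g @` Phi = adj Phi i -> regular P.
Proof.
move=> ltin ag gPhi.
have [|h ah hPhi] := @orbit_adj _ aut_subgroup (fun _ => id) s_aut Phi i 0%N
  ltin n_gt0 fPhi.
  by exists g.
have trans A : flag A -> exists2 k, automorphism k & A = k @` Phi.
  move=> fA; have [//|[k ak e]] :=
    flag_orbits aut_subgroup (fun _ => id) s_aut fA.
  exists (h * k); first exact: autM.
  by rewrite image_symM -hPhi aut_adj // -e adjK.
move=> A B /trans[k ak ->] /trans[l al ->].
exists (k^-1 * l); first by apply: autM => //; apply: autV.
by rewrite image_symM image_symK.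
Qed.

(** Otherwise some [g] sends Phi outside its orbit under [S]; the neighbour of Phi g in rank 0 is
    then Phi h with [h] in [S], and h g^-1 maps Phi to Phi^0. *)
Lemma rotations_generate S : ~ regular P -> subgroup S ->
  S `<=` @automorphism n P -> (forall i, (0 < i < n)%N -> S (s i)) ->
  @automorphism n P `<=` S.
Proof.
move=> nreg gS Sa Ss g ag.
have [[h Sh e]|[h Sh e]] := flag_orbits gS Sa Ss (aut_flag ag fPhi).
  by rewrite (aut_flag_inj fPhi ag (Sa _ Sh) e).
case: nreg; apply: (@regular_of_adj 0%N (h * g^-1)) => //.
  by apply: autM; [apply: Sa | apply: autV].
by rewrite image_symM -e -aut_adj // image_symK.
Qed.

End RotationOrbits.

(** * Swapping vertices, and flags agreeing outside one or two ranks *)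

Section VertexSwap.
Variables (n : nat) (P : polytope n).
Implicit Types (A B : set P) (g : sym P) (x y : P).
Local Open Scope ring_scope.

(** Between a vertex and a face of positive rank above it there is an edge. Since [g] fixes this
    edge, the image of the vertex is still below the unmoved face. *)
Lemma vertex_swap g : (1 < n)%N -> automorphism g -> (g * g = 1)%g ->
  (forall x, rank x = 1%:Z -> g x = x) ->
  exists2 h : sym P, automorphism h &
    forall x, h x = if rank x == 0%:Z then g x else x.
Proof.
move=> n1 ag gg g1.
pose f x := if rank x == 0%:Z then g x else x.
have ggx x : g (g x) = x by have := congr1 (fun h : sym P => h x) gg.
have fK : cancel f f.
  by move=> x; rewrite /f; case rx: (rank x == _); rewrite ?aut_rank // rx ?ggx.
have f_le x y : (x <= y)%O -> (f x <= f y)%O.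
  move=> xy; have := rank_le xy; rewrite /f.
  have bx := rank_bounds x; have byy := rank_bounds y.
  case: eqP => rx; case: eqP => ry rxy //; first by rewrite ag.
    have [A [fA Ax Ay]] := le_in_flag xy.
    have [|e Ae re] := @flag_face _ _ _ 1%:Z fA; first by lia.
    apply: (@le_trans _ _ (g e)).
      by rewrite ag; apply: (chain_le (flag_chain fA)) => //; lia.
    by rewrite g1 //; apply: (chain_le (flag_chain fA)) => //; lia.
  by apply: rank_least; lia.
exists (Sym fK fK) => // x y /=.
by apply/idP/idP => [/f_le|/f_le//]; rewrite !fK.
Qed.

Lemma adj_or A B i : (i < n)%N -> flag A -> flag B ->
  (forall x, A x -> rank x <> i%:Z -> B x) -> B = A \/ B = adj A i.
Proof.
move=> ltin fA fB AB; have [|BA] := pselect (B = A); first by left.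
by right; apply/esym/adj_eq.
Qed.

(** Exchanging in [A] only the face of rank i for that of [B] gives a flag [D], which is [A] or its
    i-neighbour; then [B] is [D] or its j-neighbour. *)
Lemma adj2_or A B i j : (i.+1 < j)%N -> (j < n)%N -> flag A -> flag B ->
  (forall x, A x -> rank x <> i%:Z -> rank x <> j%:Z -> B x) ->
  [\/ B = A, B = adj A i, B = adj A j | B = adj (adj A j) i].
Proof.
move=> ij jn fA fB AB; have ltin : (i < n)%N by lia.
have [|b Bb rb] := @flag_face _ _ B i%:Z fB; first by lia.
have BA x : rank x <> i%:Z -> rank x <> j%:Z -> B x -> A x.
  move=> ri rj Bx; have [y Ay ry] := flag_face fA (rank_bounds x).
  by rewrite (chain_rank_inj (flag_chain fB) Bx _ (esym ry)) //; apply: AB;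
    rewrite ?ry.
pose D := [set y | A y /\ rank y <> i%:Z \/ y = b].
have fD : flag D.
  apply: flag_replace => // y Ay ry; apply: (chain_le (flag_chain fB)) => //;
    try lia.
    by apply: AB => //; lia.
  by apply: AB => //; lia.
have Dor : D = A \/ D = adj A i by apply: adj_or => // x Ax rx; left.
have [->|->] : B = D \/ B = adj D j.
  by apply: adj_or => // x [[Ax rx] rj|->] //; apply: AB.
  by case: Dor => ->; [apply: Or41 | apply: Or42].
by case: Dor => ->; [apply: Or43 | rewrite adjC //; apply: Or44].
Qed.

End VertexSwap.

(** * Orders of elements and dihedral groups *)

Section Orders.
Variable G : groupType.
Implicit Types (a b g h x y : G) (m : nat).
Local Open Scope group_scope.

Lemma has_orderJ x y m : has_order x m -> has_order (x ^ y) m.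
Proof.
move=> xm k; rewrite -xm -conjXg; split=> [/eqP|->]; last exact: conj1g.
by rewrite conjg_eq1 => /eqP.
Qed.

Lemma has_orderV x m : has_order x m -> has_order x^-1 m.
Proof.
move=> xm k; rewrite -xm expVgn; split=> [/eqP|->]; last exact: invg1.
by rewrite invg_eq1 => /eqP.
Qed.

(** No odd power is 1, and the even ones are powers of the square; m = 0 covers infinite order. *)
Lemma has_order_double x m : has_order (x * x) m ->
  (forall k, x ^+ k.*2.+1 <> 1) -> has_order x (2 * m).
Proof.
move=> xm xodd k; rewrite -(odd_double_half k).
case: (odd k); rewrite ?add1n ?add0n.
  split=> [/xodd//|dv]; have : (2 %| (k./2).*2.+1)%N by apply: dvdn_trans dv;
    apply: dvdn_mulr.
  by rewrite dvdn2 /= odd_double.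
by rewrite -mul2n expgnA expg2 dvdn_pmul2l.
Qed.

(* Every element of the dihedral group <a, b> is x or a * x for such an x; no
   normal form of its elements is needed. *)
Definition inverted_rotation a b x :=
  a * b * x = x * (a * b) /\ a * x * a = x^-1.

(** Since a b commutes with x, b x b = a (a b x) b = a (x a b) b = a x a. *)
Lemma inverted_rotation_conj a b x : a * a = 1 -> b * b = 1 ->
  inverted_rotation a b x -> b * x * b = x^-1.
Proof.
move=> aa bb [cx ax].
have -> : b * x * b = a * (a * b * x) * b by rewrite !mulgA aa mul1g.
by rewrite cx -ax !mulgA -[_ * b * b]mulgA bb mulg1.
Qed.

Lemma inverted_rotationM a b x : a * a = 1 -> b * b = 1 ->
  inverted_rotation a b x -> inverted_rotation a b (a * b * x).
Proof.
move=> aa bb [cx ax]; split; first by rewrite -[in RHS]mulgA -cx.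
rewrite invgM -ax invgM (mulg1_eq aa) (mulg1_eq bb) cx !mulgA.
by [].
Qed.

(** As b a is the inverse of a b, this and [inverted_rotationM] cover both directions of
    rotation. *)
Lemma inverted_rotationV a b x : a * a = 1 -> b * b = 1 ->
  inverted_rotation a b x -> inverted_rotation a b (b * a * x).
Proof.
move=> aa bb [cx ax].
have e : b * a = (a * b)^-1 by rewrite invgM (mulg1_eq aa) (mulg1_eq bb).
have cx' : b * a * x = x * (b * a).
  by rewrite e; apply: (mulgI (a * b)); rewrite mulVKg mulgA cx mulgK.
split; first by rewrite -[in RHS]mulgA -cx e mulVKg mulKg.
rewrite invgM -ax invgM (mulg1_eq aa) (mulg1_eq bb) cx' !mulgA.
by rewrite -!(mulgA _ a a) aa !mulg1.
Qed.
End Orders.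

(** * Properly self-dual chiral 4-polytopes *)

Section PetrieDual.
Variables (P : polytope 4) (Phi : set P) (s : nat -> sym P) (w : sym P).
Implicit Types (A B : set P) (g h r : sym P) (x y : P).
Local Open Scope group_scope.

Hypothesis nreg : ~ regular P.
Hypothesis fPhi : flag Phi.
Hypothesis s_aut : forall i, (0 < i < 4)%N -> automorphism (s i).
Hypothesis s_Phi : forall i, (0 < i < 4)%N -> s i @` Phi = adj (adj Phi i) i.-1.
Hypothesis w_dual : duality w.
Hypothesis w_sq : w * w = 1.
Hypothesis w_Phi : w @` Phi = Phi.

(** * Involutions and relations in the extended group *)

Variables t0 t1 b : sym P.
Hypothesis t0E : t0 = s 1%N * s 2 * s 3.
Hypothesis t1E : t1 = s 1%N * s 2.
Hypothesis bE : b = s 2 * s 3.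

Lemma s1_aut : automorphism (s 1%N). Proof. exact: s_aut. Qed.
Lemma s2_aut : automorphism (s 2). Proof. exact: s_aut. Qed.
Lemma s3_aut : automorphism (s 3). Proof. exact: s_aut. Qed.
Hint Resolve s1_aut s2_aut s3_aut : core.

Lemma t1_aut : automorphism t1. Proof. by rewrite t1E; apply: autM. Qed.
Lemma t0_aut : automorphism t0.
Proof. by rewrite t0E; apply: autM => //; apply: autM. Qed.
Lemma b_aut : automorphism b. Proof. by rewrite bE; apply: autM. Qed.
Hint Resolve t0_aut t1_aut b_aut : core.

(** Phi s_1 s_2 = (Phi s_2)^{1,0} = Phi^{2,1,1,0} = Phi^{2,0}; the next two images are computed in
    the same way. *)
Lemma t1_Phi : t1 @` Phi = adj (adj Phi 2) 0.
Proof.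
rewrite t1E image_symM s_Phi // aut_adj2 // s_Phi //=.
by rewrite adjK //; apply: adj_flag.
Qed.

Lemma t0_Phi : t0 @` Phi = adj (adj Phi 3) 0.
Proof.
rewrite t0E -t1E image_symM t1_Phi aut_adj2 // s_Phi //=.
by rewrite adjK //; apply: adj_flag.
Qed.

Lemma b_Phi : b @` Phi = adj (adj Phi 3) 1.
Proof.
rewrite bE image_symM s_Phi // aut_adj2 // s_Phi //=.
by rewrite adjK //; apply: adj_flag.
Qed.

(** Phi g g = (Phi g)^{i,j} = Phi^{i,j,i,j}, and adjacencies in non-consecutive ranks commute. *)
Lemma adj2_invol g i j : (j.+1 < i < 4)%N -> automorphism g ->
  g @` Phi = adj (adj Phi i) j -> g * g = 1.
Proof.
move=> /andP[ij i4] ag e; have j4 : (j < 4)%N by lia.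
have fi := adj_flag i4 fPhi.
apply: (aut_flag_inj fPhi);
  [exact: autM | exact: aut_id | rewrite image_symM image_sym1].
rewrite e aut_adj2 // e -adjC //; last exact: adj_flag.
by rewrite adjK // ?adjK //; apply: adj_flag.
Qed.

Lemma t0_sq : t0 * t0 = 1. Proof. by apply: adj2_invol t0_Phi. Qed.
Lemma t1_sq : t1 * t1 = 1. Proof. by apply: adj2_invol t1_Phi. Qed.
Lemma b_sq : b * b = 1. Proof. by apply: adj2_invol b_Phi. Qed.

Lemma w_conj g i j : (i < 4)%N -> (j < 4)%N -> automorphism g ->
  g @` Phi = adj (adj Phi i) j ->
  automorphism (w * g * w) /\ (w * g * w) @` Phi =
    adj (adj Phi (3 - i)) (3 - j).
Proof.
move=> i4 j4 ag e; split; first by apply: dualM => //; apply: dual_autM.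
rewrite !image_symM w_Phi e dual_adj //; last exact: adj_flag.
by rewrite dual_adj // w_Phi.
Qed.

Lemma w_t1 : w * t1 * w = b.
Proof.
have [a e] := @w_conj _ 2 0 isT isT t1_aut t1_Phi.
by apply: (aut_flag_inj fPhi) => //; rewrite e b_Phi adjC.
Qed.

Lemma w_t0 : w * t0 = t0 * w.
Proof.
have [a e] := @w_conj _ 3 0 isT isT t0_aut t0_Phi.
have {}e : w * t0 * w = t0.
  by apply: (aut_flag_inj fPhi) => //; rewrite e t0_Phi adjC.
by rewrite -[in RHS]e -[in RHS]mulgA w_sq mulg1.
Qed.

Lemma s3E : s 3 = t1 * t0.
Proof. by rewrite t0E -t1E mulgA t1_sq mul1g. Qed.

Lemma s1E : s 1%N = t0 * b.
Proof.
have -> : t0 = s 1%N * b by rewrite t0E bE mulgA.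
by rewrite -mulgA b_sq mulg1.
Qed.

Lemma t1w_sq : (t1 * w) * (t1 * w) = t1 * b.
Proof. by rewrite -w_t1 !mulgA. Qed.

(** From s_1 = t0 b and s_3 = t1 t0 one has s_1 s_3 = t0 (b t1) t0, and b t1 is inverse to t1 b.
    This brings in the left-Petrie polygons. *)
Lemma t1bE : t1 * b = ((s 1%N * s 3) ^ t0)^-1.
Proof.
rewrite s1E s3E conjgE (mulg1_eq t0_sq) !mulgA t0_sq mul1g -!mulgA t0_sq mulg1.
by rewrite invgM (mulg1_eq t1_sq) (mulg1_eq b_sq).
Qed.

Lemma t0t1E : t0 * t1 = s 3 ^ t1.
Proof. by rewrite s3E conjgE (mulg1_eq t1_sq) !mulgA t1_sq mul1g. Qed.

(** * Stabilizers of base faces *)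

Let base_face (i : nat) x := Phi x /\ rank x = i%:Z%R.

Lemma base_face_ex i : (i < 4)%N -> exists x, base_face i x.
Proof.
by move=> i4; have [|x] := @flag_face _ _ _ (i%:Z)%R fPhi; [lia | exists x].
Qed.

Lemma base_face_uniq i x y : base_face i x -> base_face i y -> x = y.
Proof.
by move=> [Ax rx] [Ay ry]; apply: (chain_rank_inj (flag_chain fPhi));
  rewrite ?rx.
Qed.

(** Phi and Phi^{i,j} share their faces of ranks other than i and j. *)
Lemma aut_fix_face g i j k x : automorphism g -> (i < 4)%N -> (j < 4)%N ->
  g @` Phi = adj (adj Phi i) j -> k <> i -> k <> j -> base_face k x -> g x = x.
Proof.
move=> ag i4 j4 e ki kj [Ax rx].
have gx : (g @` Phi) (g x) by exists x.
move: gx; rewrite e => gx.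
apply: (chain_rank_inj (flag_chain fPhi)) => //; last exact: aut_rank.
have r i' : k <> i' -> rank (g x) <> i'%:Z%R by rewrite aut_rank // rx; lia.
apply/(adj_sub i4 fPhi (r _ ki)); apply/(adj_sub j4 _ (r _ kj)) => //.
exact: adj_flag.
Qed.

Lemma w_base x i : base_face i x -> (i < 4)%N -> base_face (3 - i) (w x).
Proof.
move=> [Ax rx] i4; split; first by rewrite -w_Phi; exists x.
by rewrite dual_rank // rx; lia.
Qed.

(* Otherwise exchanging the two vertices of every edge would be an automorphism
   that maps Phi to an adjacent flag. *)
Lemma t0_not_central : ~ (t0 * t1 = t1 * t0).
Proof.
move=> c01.
(* The centralizer of [t0] contains the rotations, which generate the automorphism group. *)
have c0 : @automorphism 4 P `<=` [set g | automorphism g /\ t0 * g = g * t0].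
  apply: (rotations_generate fPhi _ s_aut s_Phi nreg) => //.
  - split=> [|g h [ag cg] [ah ch]|g [ag cg]].
    + by split; [apply: aut_id | rewrite mulg1 mul1g].
    + by split; [apply: autM | rewrite mulgA cg -mulgA ch mulgA].
    + split; first exact: autV.
      by apply: (mulgI g); rewrite mulVKg mulgA -cg mulgK.
  - by move=> g [].
  (* Conjugating the hypothesis by [w] turns [t1] into [b] and keeps [t0]. *)
  - have cb : t0 * b = b * t0.
      by rewrite -w_t1 !mulgA -w_t0 -[_ * t0 * t1]mulgA c01 !mulgA -[_ * t0 *
        w]mulgA -w_t0 !mulgA.
    have c1 : t0 * s 1%N = s 1%N * t0 by rewrite s1E -mulgA -cb mulgA.
    have c3 : t0 * s 3 = s 3 * t0 by rewrite s3E mulgA c01.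
    have c2 : t0 * s 2 = s 2 * t0.
      have -> : s 2 = b * (s 3)^-1 by rewrite bE mulgK.
      have c3' : t0 * (s 3)^-1 = (s 3)^-1 * t0.
        by apply: (mulgI (s 3)); rewrite mulVKg mulgA -c3 mulgK.
      by rewrite mulgA cb -mulgA c3' mulgA.
    by move=> [|[|[|[|]]]] //= _; split=> //; apply: s_aut.
have [e1 b1] := @base_face_ex 1 isT.
have [v bv] := @base_face_ex 0 isT.
have t0e1 : t0 e1 = e1.
  by apply: (aut_fix_face t0_aut _ _ t0_Phi _ _ b1).
have edge x : rank x = 1%:Z%R -> t0 x = x.
  move=> rx; have [A fA Ax] := face_in_flag x.
  (* One of [A] and [adj A 0] is an image of Phi, and both have the edge [x]. *)
  have [g ag gx] : exists2 g, automorphism g & x = g e1.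
    have := flag_orbits fPhi isT s_aut s_Phi (aut_subgroup P) (fun _ => id)
      s_aut fA.
    case=> // -[g ag e]; exists g => //.
      have gA : A (g e1) by rewrite e; exists e1 => //; case: b1.
      apply: (chain_rank_inj (flag_chain fA)) => //.
      by rewrite aut_rank // rx; case: b1.
    have gA : (adj A 0) (g e1) by rewrite e; exists e1 => //; case: b1.
    have rg : rank (g e1) = 1%:Z%R by rewrite aut_rank //; case: b1.
    apply: (chain_rank_inj (flag_chain fA)) => //; last by rewrite rg.
    by apply/(@adj_sub _ _ _ 0 _ _ fA); rewrite ?rg.
  have [_ cg] := c0 _ ag.
  rewrite gx -[in RHS]t0e1.
  by have := congr1 (fun h : sym P => h e1) cg => /=.
have [h ah hE] := @vertex_swap _ P t0 isT t0_aut t0_sq edge.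
have rv : rank v = 0 by case: bv.
apply: nreg; apply: (@regular_of_adj _ _ _ _ fPhi isT s_aut s_Phi 0%N h) => //.
apply/esym/adj_eq => //; first exact: aut_flag.
  (* The vertex [t0 v] is the new vertex of Phi^{3,0}, hence not in Phi. *)
  move=> hPhi.
  have : (h @` Phi) (t0 v) by exists v; [case: bv | rewrite hE rv].
  rewrite hPhi => t0v.
  apply: (@adj_new _ P (adj Phi 3) 0 (t0 v)) => //.
  - exact: adj_flag.
  - by rewrite aut_rank.
  - by rewrite -t0_Phi; exists v => //; case: bv.
  - by apply/(adj_sub _ fPhi) => //; rewrite aut_rank // rv.
move=> x Ax rx; exists x => //; rewrite hE.
by case: eqP.
Qed.

Lemma t0_neq1 : t0 <> 1.
Proof. by move=> e; apply: t0_not_central; rewrite e mulg1 mul1g. Qed.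

Lemma t0_neq_t1 : t0 <> t1.
Proof. by move=> e; apply: t0_not_central; rewrite e. Qed.

Lemma t1_neq1 : t1 <> 1.
Proof. by move=> e; apply: t0_not_central; rewrite e mulg1 mul1g. Qed.

Lemma not_adj g i : (i < 4)%N -> automorphism g -> g @` Phi <> adj Phi i.
Proof.
by move=> i4 ag e; apply/nreg/(regular_of_adj fPhi _ s_aut s_Phi i4 ag e).
Qed.

(** Phi g agrees with Phi in ranks 1 and 2, so it is Phi, Phi^0, Phi^3 or Phi^{3,0}; chirality
    excludes the two adjacent flags. *)
Lemma aut_fix_edge_face g x y : automorphism g ->
  base_face 1 x -> base_face 2 y -> g x = x -> g y = y -> g = 1 \/ g = t0.
Proof.
move=> ag bx by_ gx gy.
have [|z Pz rz rz'|e|e|e|e] := @adj2_or _ P Phi (g @` Phi) 0 3 isT isT fPhi.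
- exact: aut_flag.
- have [r1|r1] := eqVneq (rank z) 1%R.
    by exists x; [case: bx | rewrite gx; apply: base_face_uniq bx _].
  have [r2|r2] := eqVneq (rank z) 2%R.
    by exists y; [case: by_ | rewrite gy; apply: base_face_uniq by_ _].
  apply: flag_improper; first exact: aut_flag.
  by have := rank_bounds z; move: rz rz' r1 r2; lia.
- by left; apply: (aut_flag_inj fPhi) => //; rewrite image_sym1.
- by case: (not_adj _ ag e).
- by case: (not_adj _ ag e).
- by right; apply: (aut_flag_inj fPhi) => //; rewrite t0_Phi.
Qed.

(** * Lambda as a string C-group *)

Definition petrie_gen : nat -> sym P := nth 1 [:: t0; t1; w].
Notation H := (parabolic petrie_gen).

Lemma petrie_gen_sq i : (i < 3)%N -> petrie_gen i * petrie_gen i = 1.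
Proof.
by case: i => [|[|[|//]]] _; [apply: t0_sq | apply: t1_sq | apply: w_sq].
Qed.

Lemma parabolic1_rotation g : H 1%N g ->
  exists r, inverted_rotation t1 w r /\ (g = r \/ g = t1 * r).
Proof.
move: g; apply: (@parabolic_ind _ petrie_gen
  [set g | exists r, inverted_rotation t1 w r /\ (g = r \/ g = t1 * r)]).
- exact: petrie_gen_sq.
- exists 1; split; last by left.
  by split; rewrite ?mul1g ?mulg1 // t1_sq invg1.
- move=> [|[|[|//]]] g // _ _ [r [rr gr]]; rewrite /petrie_gen /=.
    exists r; split=> //; case: gr => ->; first by right.
    by left; rewrite mulgA t1_sq mul1g.
  (* Here w r = t1 (t1 w r), while w (t1 r) = (w t1) r is an inverted rotation itself. *)
  case: gr => ->.
    exists (t1 * w * r); split; first exact: inverted_rotationM t1_sq w_sq rr.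
    by right; rewrite !mulgA t1_sq mul1g.
  exists (w * t1 * r); split; first exact: inverted_rotationV t1_sq w_sq rr.
  by left; rewrite mulgA.
Qed.

(** The group <t0, w> consists of 1, t0, w and t0 w, and the last two are dualities. *)
Lemma parabolic2_aut g : H 2 g -> automorphism g -> g = 1 \/ g = t0.
Proof.
move=> Hg; suff : (g = 1 \/ g = t0) \/ (g = w \/ g = t0 * w).
  case=> // -[->|->] ag; first by case: (duality_not_aut w_dual ag).
  by case: (duality_not_aut (aut_dualM w_dual t0_aut) ag).
move: g Hg; apply: (@parabolic_ind _ petrie_gen
  [set g | (g = 1 \/ g = t0) \/ (g = w \/ g = t0 * w)]).
- exact: petrie_gen_sq.
- by left; left.
- move=> [|[|[|//]]] g // _ _; rewrite /petrie_gen /=.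
    case=> -[->|->]; rewrite ?mulg1 ?mulgA ?t0_sq ?mul1g; auto.
  by case=> -[->|->]; rewrite ?mulg1 ?mulgA ?w_t0 ?w_sq -?mulgA ?w_sq ?mulg1;
    auto.
Qed.

Lemma parabolic3_aut g : H 3 g ->
  automorphism g /\ forall x, base_face 1 x -> g x = x.
Proof.
move: g; apply: (@parabolic_ind _ petrie_gen
  [set g | automorphism g /\ forall x, base_face 1 x -> g x = x]).
- exact: petrie_gen_sq.
- by split; [apply: aut_id |].
- have fix1 k : k = t0 \/ k = t1 ->
    automorphism k /\ forall x, base_face 1 x -> k x = x.
    case=> ->; split=> // x bx.
      exact: (aut_fix_face t0_aut _ _ t0_Phi _ _ bx).
    exact: (aut_fix_face t1_aut _ _ t1_Phi _ _ bx).
  move=> [|[|[|//]]] g // _ _ [ag fg].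
    have [ak fk] := fix1 _ (or_introl erefl).
    by split=> [|x bx]; [apply: autM | rewrite /= fk ?fg].
  have [ak fk] := fix1 _ (or_intror erefl).
  by split=> [|x bx]; [apply: autM | rewrite /= fk ?fg].
Qed.

Lemma petrie_inter g : H 1%N g -> H 3 g -> g = 1 \/ g = t1.
Proof.
move=> /parabolic1_rotation[r [rr gr]] Hg.
have Ht1 : H 3 t1 by apply: mem_generated; exists 1%N.
(* Passing from [g] to t1 g, if necessary, stays inside [H 3]. *)
have Hr : H 3 r.
  case: gr Hg => -> // Hg.
  by rewrite -(mul1g r) -t1_sq -mulgA; apply: generatedM.
have [ar fr] := parabolic3_aut Hr.
have [x bx] := @base_face_ex 1 isT.
have bwx := w_base bx isT.
have ww y : w (w y) = y by have := congr1 (fun h : sym P => h y) w_sq.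
(* Since w r w = r^-1 and [r] fixes the base edge [x], it fixes the base 2-face w x as well. *)
have rwx : r (w x) = w x.
  have wrw := inverted_rotation_conj t1_sq w_sq rr.
  have : w (r (w x)) = r^-1 x by rewrite -wrw.
  rewrite /= -{2}(fr _ bx) sym_funK => e.
  by rewrite -[LHS]ww e.
have [r1|rt0] := aut_fix_edge_face ar bx bwx (fr _ bx) rwx.
  by case: gr => ->; rewrite r1 ?mulg1; auto.
(* That [t1] inverts the involution [t0] means that the two commute. *)
case: t0_not_central; have [_] := rr; rewrite rt0 (mulg1_eq t0_sq) => e.
by rewrite -[in LHS]e -mulgA t1_sq mulg1.
Qed.

(** The group <t1, w> meets <t0, t1> at most in 1 and t1, the only automorphisms in <t0, w> are 1
    and t0, and <t0, t1> contains no duality. *)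
Lemma petrie_irred i : (i < 3)%N -> ~ H i.+1 (petrie_gen i).
Proof.
case: i => [|[|[|//]]] _ Hg.
- have Ht0 : H 3 t0 by apply: mem_generated; exists 0%N.
  by have [/t0_neq1|/t0_neq_t1] := petrie_inter Hg Ht0.
- by have [/t1_neq1|/esym/t0_neq_t1] := parabolic2_aut Hg t1_aut.
- by have [/(duality_not_aut w_dual)] := parabolic3_aut Hg.
Qed.

Definition petrie_string : stringC (sym P) :=
  StringC petrie_gen_sq (esym w_t0) petrie_irred petrie_inter.

Lemma generated_petrie : generated [set t0; t1; w] = H 0.
Proof.
congr generated; apply/seteqP; split=> [_ [[->|->]|->]|_ [i [i3 _] <-]].
- by exists 0%N.
- by exists 1%N.
- by exists 2%N.
- by case: i i3 => [|[|[|//]]] _; [left; left | left; right | right].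
Qed.

(** Rotations are words in the generators, by way of b = w t1 w, and they generate all
    automorphisms; a duality is an automorphism times [w]. *)
Lemma petrie_extended : H 0 = @extended_group 4 P.
Proof.
have Ht0 : H 0 t0 by apply: mem_generated; exists 0%N.
have Ht1 : H 0 t1 by apply: mem_generated; exists 1%N.
have Hw : H 0 w by apply: mem_generated; exists 2%N.
apply/seteqP; split=> [|g].
  apply: parabolic_ind => [||i g i3 _ eg]; first exact: petrie_gen_sq.
    by left; apply: aut_id.
  have : petrie_gen i = t0 \/ petrie_gen i = t1 \/ petrie_gen i = w.
    by case: i i3 => [|[|[|//]]] _; auto.
  case=> [->|[->|->]]; case: eg => eg.
  - by left; apply: autM.
  - by right; apply: aut_dualM.
  - by left; apply: autM.
  - by right; apply: aut_dualM.
  - by right; apply: dual_autM.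
  - by left; apply: dualM.
have autH : @automorphism 4 P `<=` H 0.
  suff : @automorphism 4 P `<=` H 0 `&` @automorphism 4 P by move=> sub h
    /sub[].
  apply: (rotations_generate fPhi isT s_aut s_Phi nreg) => //.
  - have [H1 HM HV] := generated_subgroup (petrie_gen @` [set i
      | (i < 3)%N /\ i.+1 <> 0%N]).
    split=> [|h k [Hh ah] [Hk ak]|h [Hh ah]].
    + by split; [exact: H1 | exact: aut_id].
    + by split; [apply: HM | apply: autM].
    + by split; [apply: HV | apply: autV].
  - have Hb : H 0 b by rewrite -w_t1; do 2?apply: generatedM.
    have H1 : H 0 (s 1%N) by rewrite s1E; apply: generatedM.
    have H3 : H 0 (s 3) by rewrite s3E; apply: generatedM.
    have H2 : H 0 (s 2).
      rewrite -(mulKg (s 1%N) (s 2)) -t1E; apply: generatedM => //.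
      exact: generatedV.
    by move=> [|[|[|[|]]]] //= _; split=> //; apply: s_aut.
case=> [/autH//|dg]; rewrite -(mulg1 g) -w_sq mulgA; apply: generatedM => //.
by apply: autH; apply: dualM.
Qed.

(** Odd powers of t1 w are dualities, hence never 1; its square is conjugate to the inverse of s_1
    s_3. *)
Lemma petrie_order l : has_order (s 1%N * s 3) l -> has_order (t1 * w) (2 * l).
Proof.
move=> sl; apply: has_order_double => [|k e].
  by rewrite t1w_sq t1bE; apply/has_orderV/has_orderJ.
have dtw : duality (t1 * w) by apply: aut_dualM.
have : duality ((t1 * w) ^+ k.*2.+1).
  elim: k {e} => [|k IH]; first by rewrite expg1.
  rewrite doubleS expgS (expgS _ k.*2.+1).
  by apply: dual_autM => //; apply: dualM.
by rewrite e => /duality_not_aut; apply; apply: aut_id.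
Qed.

End PetrieDual.

Local Open Scope group_scope.

Theorem theorem2 (P : polytope 4) (Phi : set P) (sigma : nat -> sym P)
    (omega : sym P) (p q s : nat)
    (Pchiral : chiral P)
    (Pdual : properly_self_dual P)
    (sigma_gen : chiral_generators Phi sigma)
    (Ptype : chiral_type sigma [:: p; q; p])
    (omega_pol : polarity omega)
    (omega_fix : omega @` Phi = Phi)
    (s_length : left_petrie_length sigma s) :
  let tau0 := sigma 1%N * sigma 2%N * sigma 3%N in
  let tau1 := sigma 1%N * sigma 2%N in
  let tau2 := omega in
  let Lambda : set (sym P) := generated [set tau0; tau1; tau2] in
  (exists M : polytope 3, regular_of_type M [:: p; (2 * s)%N] /\
     isomorphic Lambda (@automorphism 3 M)) /\
  Lambda = @extended_group 4 P.
Proof.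
have [_ nreg _] := Pchiral.
have [[fPhi rot] s_Phi] := sigma_gen.
have s_aut i : (0 < i < 4)%N -> automorphism (sigma i) by move=> /rot[].
have [w_dual w2] := omega_pol.
have w_sq : (omega * omega = 1)%g by rewrite -expg2; apply/w2.
move=> tau0 tau1 tau2 Lambda.
have LambdaE : Lambda = parabolic (petrie_gen omega tau0 tau1) 0.
  exact: generated_petrie.
rewrite LambdaE; split; last first.
  exact: (petrie_extended nreg fPhi s_aut s_Phi w_dual w_sq omega_fix erefl
    erefl erefl).
pose C := petrie_string nreg fPhi s_aut s_Phi w_dual w_sq omega_fix
  (erefl tau0) (erefl tau1) erefl.
exists (coset_polytope C); split; last exact: (translation_iso C).
have [_ sp] := Ptype.
apply: coset_polytope_type.
  (* The product is a conjugate of sigma_3, whose order is the third entry of the type. *)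
  rewrite /= (t0t1E fPhi s_aut s_Phi (erefl tau0) (erefl tau1)).
  by apply: has_orderJ; apply: (sp 3).
exact: (petrie_order fPhi s_aut s_Phi w_dual omega_fix (erefl tau0) (erefl
  tau1) erefl).
Qed.
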